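(* Let $B$ be a separable unital $C^*$-algebra. Let $\Delta\subset \mathcal{E}(B)\times \mathcal{E}(B)$ be a weak-$*$ closed, convex pre-order, and let $\Omega=\max(\Delta)\cap\mathcal{E}_p(B)$ be the set of pure $\Delta$-maximal states. Then the following statements are equivalent. (i) There is a Borel measurable subset $X\subset \mathcal{E}_p(B)$ such that $\max(\Delta)=\Sigma_X$. (ii) The set $\Omega$ is a $\Delta$-boundary. (iii) The order $\Delta$ is hyperrigid.
   Context: $\mathcal{E}(B)$ is the state space of $B$ with the weak-$*$ topology and $\mathcal{E}_p(B)$ is the set of pure states (a Borel set when $B$ is separable). A pre-order on $\mathcal{E}(B)$ is viewed as a subset $\Delta\subset\mathcal{E}(B)\times\mathcal{E}(B)$; ''weak-$*$ closed'' and ''convex'' refer to this subset. A state $\phi$ is $\Delta$-maximal if $(\phi,\psi)\in\Delta$ implies $\psi=\phi$; $\max(\Delta)$ is the set of $\Delta$-maximal states. For a state $\phi$, $\mathcal{R}_\phi$ is the set of Borel probability measures $\mu$ on $\mathcal{E}(B)$ concentrated on $\mathcal{E}_p(B)$ and satisfying $\phi(b)=\int\omega(b)\,d\mu(\omega)$ for all $b\in B$. For a Borel set $X\subset\mathcal{E}_p(B)$, $\Sigma_X$ is the set of states $\phi$ for which there exists $\mu\in\mathcal{R}_\phi$ concentrated on $X$, and $\Sigma^X$ is the set of states $\phi$ for which every $\mu\in\mathcal{R}_\phi$ is concentrated on $X$. A Borel set $X\subset\mathcal{E}_p(B)$ is a $\Delta$-boundary if $\max(\Delta)=\Sigma^X=\Sigma_X$.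 The order $\Delta$ is hyperrigid if $\Sigma_\Omega\subset\max(\Delta)$. (Under the hypotheses, $\Omega$ is Borel measurable.) *)

(* Defs.v *)
From HB Require Import structures.
From mathcomp Require Import all_boot all_order all_algebra.
From mathcomp Require Import interval_inference.
From mathcomp Require Import all_classical all_reals all_analysis.
From mathcomp Require Import complex ring.
Import Order.TTheory GRing.Theory Num.Theory numFieldNormedType.Exports.

Set Implicit Arguments.
Unset Strict Implicit.
Unset Printing Implicit Defensive.

Local Open Scope classical_set_scope.
Local Open Scope ring_scope.
Local Open Scope convex_scope.

(* The product is a field of the mixin because the library has no join of
   normed modules and (noncommutative) algebras, and such a join cannot be
   added after [Num.NumDomain].  The norm takes its values in the scalar
   field, as for every [normedModType].  The zero algebra is not excluded. *)
HB.mixin Record isUnitalCStarAlgebra (K : numClosedFieldType) A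
    & CompleteNormedModule K A := {
  cmul : A -> A -> A ;
  cone : A ;
  cstar : A -> A ;
  cmulA : associative cmul ;
  cmul1a : left_id cone cmul ;
  cmula1 : right_id cone cmul ;
  cmulDl : left_distributive cmul +%R ;
  cmulDr : right_distributive cmul +%R ;
  cmulZl : forall (c : K) (a b : A), cmul (c *: a) b = c *: cmul a b ;
  cmulZr : forall (c : K) (a b : A), cmul a (c *: b) = c *: cmul a b ;
  cstarK : involutive cstar ;
  cstarD : {morph cstar : a b / a + b} ;
  cstarZ : forall (c : K) (a : A), cstar (c *: a) = c^* *: cstar a ;
  cstarM : forall a b : A, cstar (cmul a b) = cmul (cstar b) (cstar a) ;
  cnormM : forall a b : A, `|cmul a b| <= `|a| * `|b| ;
  cnorm_cstar : forall a : A, `|cmul (cstar a) a| = `|a| ^+ 2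
}.

#[short(type="unitalCStarAlgType")]
HB.structure Definition UnitalCStarAlgebra (K : numClosedFieldType) :=
  {A of CompleteNormedModule K A & isUnitalCStarAlgebra K A}.

Definition separable (T : topologicalType) : Prop :=
  exists2 D : set T, countable D & dense D.

Section State.
Variables (R : realType) (B : unitalCStarAlgType R[i]).

(* Unital positive linear functionals (equivalently, positive functionals of
   norm one); [0 <= z] in [R[i]] says that [z] is real and nonnegative. *)
Definition states : set {ptws B -> R[i]^o} :=
  [set f : B -> R[i] |
    [/\ scalar f, (forall a, 0 <= f (cmul (cstar a) a)) & f cone = 1]].

(* The type [set_type states] carries the topology induced by that of
   pointwise convergence, which is the weak-* topology. *)
Definition state : Type := states.
HB.instance Definition _ := Topological.copy state (set_type states).

Definition evals (phi : state) : B -> R[i] := \val phi.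
Coercion evals : state >-> Funclass.

Lemma state_ext (phi psi : state) : (forall b, phi b = psi b) -> phi = psi.
Proof. by move=> h; apply/val_inj/funext. Qed.

Definition conv_fun (t : {i01 R}) (phi psi : state) (b : B) : R[i] :=
  (t%:num)%:C%C * phi b + (1 - t%:num)%:C%C * psi b.

Lemma conv_fun_state t phi psi : conv_fun t phi psi \in states.
Proof.
have [l1 p1 u1] : states (\val phi) := set_mem (valP phi).
have [l2 p2 u2] : states (\val psi) := set_mem (valP psi).
apply/mem_set; split=> [c a b|a|].
- by rewrite /conv_fun /evals l1 l2; ring.
- have t0 : 0 <= (t%:num)%:C%C by rewrite ler0c.
  have t1 : 0 <= (1 - t%:num)%:C%C by rewrite ler0c subr_ge0.
  by rewrite /conv_fun /evals addr_ge0// mulr_ge0.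
- by rewrite /conv_fun /evals u1 u2 !mulr1 -rmorphD/= addrC subrK.
Qed.

Definition state_conv t phi psi : state :=
  exist (fun f => f \in states) _ (conv_fun_state t phi psi).

Lemma state_convE t phi psi b : state_conv t phi psi b =
  (t%:num)%:C%C * phi b + (1 - t%:num)%:C%C * psi b.
Proof. by []. Qed.

Lemma state_conv1 phi psi : state_conv 1%:i01 phi psi = phi.
Proof.
by apply: state_ext => b; rewrite /evals/= /conv_fun/= subrr mul1r mul0r addr0.
Qed.

Lemma state_convmm t phi : state_conv t phi phi = phi.
Proof.
apply: state_ext => b; rewrite {1}/evals/= /conv_fun/= -mulrDl -rmorphD/=.
by rewrite addrC subrK mul1r.
Qed.

Lemma state_convC t phi psi :
  state_conv t phi psi = state_conv (1 - t%:inum)%:i01 psi phi.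
Proof.
apply: state_ext => b; rewrite /evals/= /conv_fun/= opprB.
by rewrite addrCA subrr addr0 addrC.
Qed.

Lemma state_convA : convex_quasi_associative state_conv.
Proof.
move=> p q r s a b c prs spq; apply: state_ext => x.
have CB (u : R) : (1 - u)%:C%C = 1 - u%:C%C by rewrite rmorphB.
have prs' : (p%:num)%:C%C = (r%:num)%:C%C * (s%:num)%:C%C by rewrite prs rmorphM.
have spq' : 1 - (s%:num)%:C%C = (1 - (p%:num)%:C%C) * (1 - (q%:num)%:C%C).
  by rewrite -!CB -rmorphM; congr (_%:C%C).
have pqsr := ConvexQuasiAssoc.pq_sr prs' spq'.
rewrite !state_convE !CB spq' mulrDr mulrA pqsr mulrA addrA.
by rewrite [in RHS]mulrDr !mulrA {1}prs' [(r%:num)%:C%C * _]mulrC.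
Qed.

HB.instance Definition _ :=
  isConvexSpace.Build R state state_conv1 state_convmm state_convC state_convA.

(* The pure states are the extreme points of the state space. *)
Definition pure : set state :=
  [set phi | forall (t : {i01 R}) (psi1 psi2 : state),
    0 < t%:num -> t%:num < 1 -> phi = psi1 <| t |> psi2 ->
    psi1 = phi /\ psi2 = phi].

Definition borel (X : set state) : Prop := <<s @open state >> X.

(* A [measurableType] must be pointed, but the state space has no
   distinguished point (and could be empty), so the measurable space of
   Borel sets of the state space is given an arbitrary state as base point.
   Its sigma-algebra does not depend on that point. *)
Definition pointed_state (phi : state) : Type := state.
HB.instance Definition _ phi := Choice.on (pointed_state phi).
HB.instance Definition _ phi := isPointed.Build (pointed_state phi) phi.

Definition borel_state (phi : state) :=
  g_sigma_algebraType (@open state : set (set (pointed_state phi))).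

(* The complement of [X] is [mu]-null: for Borel [X] this is [mu X = 1], and
   for an arbitrary [X] it does not involve the value of [mu] on a
   non-measurable set. *)
Definition concentrated phi (mu : probability (borel_state phi) R)
  (X : set state) : Prop := mu.-negligible (~` X : set (borel_state phi)).

(* [phi b] is the integral of the complex function [omega |-> omega b], which
   is given by its real and imaginary parts. *)
Definition represents (phi : state) (mu : probability (borel_state phi) R)
    : Prop :=
  forall b : B,
    (\int[mu]_omega (complex.Re ((omega : state) b))%:E
      = (complex.Re (phi b))%:E)%E /\
    (\int[mu]_omega (complex.Im ((omega : state) b))%:E
      = (complex.Im (phi b))%:E)%E.
Arguments represents : clear implicits.

Definition representing (phi : state) : set (probability (borel_state phi) R) :=
  [set mu | concentrated mu pure /\ represents phi mu].
Arguments representing : clear implicits.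

(* [Sigma_sub X] is $\Sigma_X$ and [Sigma_sup X] is $\Sigma^X$. *)
Definition Sigma_sub (X : set state) : set state :=
  [set phi | exists2 mu, representing phi mu & concentrated mu X].

Definition Sigma_sup (X : set state) : set state :=
  [set phi | forall mu, representing phi mu -> concentrated mu X].

End State.
Arguments pure {R} B _.
Arguments represents {R B} phi mu.
Arguments representing {R B} phi _.

Section Order.
Variables (R : realType) (B : unitalCStarAlgType R[i]).
Variable Delta : set (state B * state B).

Definition preorder_set : Prop :=
  (forall phi, Delta (phi, phi)) /\
  (forall phi psi rho, Delta (phi, psi) -> Delta (psi, rho) -> Delta (phi, rho)).

Definition convex_order : Prop :=
  forall (t : {i01 R}) (p q : state B * state B), Delta p -> Delta q ->
  Delta (p.1 <| t |> q.1, p.2 <| t |> q.2).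

Definition maximal : set (state B) :=
  [set phi | forall psi, Delta (phi, psi) -> psi = phi].

Definition pure_maximal : set (state B) := maximal `&` pure B.

Definition boundary (X : set (state B)) : Prop :=
  [/\ borel X, X `<=` pure B, maximal = Sigma_sup X & maximal = Sigma_sub X].

Definition hyperrigid : Prop := Sigma_sub pure_maximal `<=` maximal.

End Order.

(* Main.v *)
(* A state that is not [Delta]-maximal lies in one of countably many closed convex
   sets [K], on which [Re psi(b) >= Re phi(b) + e] for some [psi] above [phi], with [b] in
   a dense sequence and [e > 0].  If [mu] represents a maximal state [phi] and
   [mu K > 0], replacing the points of [K] by points above them gives, by
   convexity and closedness of [Delta], a state above [phi] that differs from
   [phi]; so [mu] is concentrated on the maximal states.  Purity is maximality
   for the closed relation "[psi <= 2 phi] as functionals", so the pure maximal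
   states form a Borel set.  With Choquet's theorem for the metrizable state space
   this yields the inclusions max(Delta) <= Sigma^Omega <= Sigma_Omega, and
   hyperrigidity closes the cycle.  If max(Delta) = Sigma_X, then X = Omega because
   a pure state is represented by its Dirac measure only. *)
Require Import Defs.
From mathcomp Require Import all_boot all_order all_algebra.
From mathcomp Require Import interval_inference.
From mathcomp Require Import all_classical all_reals all_analysis.
From mathcomp Require Import measurable_realfun.
From mathcomp Require Import complex ring lra.
Import Order.TTheory GRing.Theory Num.Theory numFieldNormedType.Exports.

Set Implicit Arguments.
Unset Strict Implicit.
Unset Printing Implicit Defensive.

Local Open Scope classical_set_scope.
Local Open Scope ring_scope.

(** * Positive functionals on C*-algebras *)

Section CStar.
Variables (R : realType) (B : unitalCStarAlgType R[i]).
Implicit Types a b h y : B.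

(** Convexity of a relation concerns two pairs at a time, while the replacement of the points of [K]
    takes place under an integral. A measurable selection is avoided: a measure is approximated by
    finitely supported ones that give [K] exactly its original mass. There any choice of points will
    do, convexity is applied finitely often, and the gap obtained is the same for all
    approximations, so that compactness and closedness carry it to the limit. This scheme serves
    maximal states, the uniqueness of the measure of a pure state, and the maximizer in Choquet's
    theorem. Conversely, measures are produced from finitely supported ones along an ultrafilter.
    Both passages use a sequence of real affine functions whose signs separate the states: [n] signs
    cut the state space into finitely many Borel cells, and on a compact space a continuous function
    oscillates little on each cell once [n] is large. Compactness itself comes from a norm bound on
    states that is uniform in the state. *)

Lemma expr2V_lt (e : R[i]) : 0 < e -> exists n, 2^-1 ^+ n < e.
Proof.
case: e => e e'; rewrite ltcE /= => /andP[/eqP -> e0].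
have := @cvg_geometric R 1 2^-1.
rewrite ger0_norm// => /(_ ltac:(lra)) /cvgrPdist_lt /(_ e e0) [n _ /(_ n)] /=.
rewrite leqnn sub0r normrN mul1r ger0_norm ?exprn_ge0// => /(_ isT) he.
exists n; have -> : 2^-1 = (2^-1)%:C%C :> R[i] by rewrite fmorphV rmorph_nat.
by rewrite -rmorphXn ltcR.
Qed.

Lemma geometric_cvg (V : completeNormedModType R[i]) (y : nat -> V) :
  (forall n, `|y n.+1 - y n| <= 2^-1 ^+ n) ->
  exists l, forall n, `|l - y n| <= 3 * 2^-1 ^+ n.
Proof.
move=> hy; have le0 n : 0 <= 2^-1 ^+ n :> R[i] by rewrite exprn_ge0.
have dist n m : `|y (n + m)%N - y n| <= 2 * 2^-1 ^+ n.
  (* The remainder of the geometric series is subtracted so that the induction on [m] closes. *)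
  suff : `|y (n + m)%N - y n| <= 2 * 2^-1 ^+ n - 2 * 2^-1 ^+ (n + m).
    by move/le_trans; apply; rewrite gerBl mulr_ge0.
  elim: m => [|m IH]; first by rewrite addn0 !subrr normr0.
  rewrite addnS -(subrKA (y (n + m)%N)) (le_trans (ler_normD _ _))//.
  apply: (le_trans (lerD (hy _) IH)).
  have -> : 2 * 2^-1 ^+ (n + m).+1 = 2^-1 ^+ (n + m) :> R[i].
    by rewrite exprS mulrA divff// mul1r.
  by rewrite addrCA lerD2l -[X in _ - X](mulrC _ 2) mulr_natr mulr2n opprD addrA subrr sub0r.
have : cauchy (y @ \oo).
  apply/cauchy_ballP => e e0.
  have [N hN] : exists n, 2^-1 ^+ n < e / 4 by apply: expr2V_lt; rewrite divr_gt0.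
  near_simpl; near=> n m; rewrite -ball_normE /=.
  have Nn : (N <= n)%N by near: n; exact: nbhs_infty_ge.
  have Nm : (N <= m)%N by near: m; exact: nbhs_infty_ge.
  rewrite -(subrKA (y N)) (le_lt_trans (ler_normD _ _))//.
  rewrite -(subnKC Nn) -(subnKC Nm) [X in _ + X]distrC.
  apply: (le_lt_trans (lerD (dist _ _) (dist _ _))).
  by rewrite -mulrDl -natrD -ltr_pdivlMl// mulrC.
move=> /cauchy_cvgP yl; exists (limn y) => n.
have e0 : 0 < 2^-1 ^+ n :> R[i] by rewrite exprn_gt0 ?invr_gt0.
move/cvgrPdist_lt : yl => /(_ _ e0)[m _ /(_ (n + m)%N)] /=.
rewrite leq_addl => /(_ isT) /ltW le1.
rewrite -(subrKA (y (n + m)%N)) (le_trans (ler_normD _ _))//.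
rewrite (le_trans (lerD le1 (dist _ _)))//.
have -> : 3 = 1 + 2 :> R[i] := natrD _ 1 2.
by rewrite [leRHS]mulrDl mul1r.
Unshelve. all: end_near. Qed.

Lemma cmulBl a b c : cmul (a - b) c = cmul a c - cmul b c.
Proof. by rewrite cmulDl -[- b]scaleN1r cmulZl scaleN1r. Qed.

Lemma cmulBr a b c : cmul a (b - c) = cmul a b - cmul a c.
Proof. by rewrite cmulDr -[- c]scaleN1r cmulZr scaleN1r. Qed.

Lemma cstarB a b : cstar (a - b) = cstar a - cstar b.
Proof. by rewrite cstarD -[- b]scaleN1r cstarZ rmorphN1 scaleN1r. Qed.

Lemma cstar1 : cstar cone = cone :> B.
Proof. by rewrite -[RHS]cstarK -[cstar cone]cmul1a cstarM !cstarK cmul1a. Qed.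

(** The C*-identity and submultiplicativity give [|b| ^ 2 <= |cstar b| |b|]; this is used for [a]
    and for [cstar a]. *)
Lemma norm_cstar a : `|cstar a| = `|a|.
Proof.
have le b : `|b| <= `|cstar b|.
  have [->|b0] := eqVneq b 0; first by rewrite normr0.
  have := cnormM (cstar b) b.
  by rewrite cnorm_cstar expr2 ler_pM2r// normr_gt0.
by apply/le_anti; rewrite le andbT -{2}[a]cstarK le.
Qed.

Lemma small_eq0 (V : normedModType R[i]) (u : V) (c : R[i]) :
  (forall n, `|u| <= c * 2^-1 ^+ n) -> u = 0.
Proof.
move=> hu; apply/eqP; apply/negPn/negP => u0.
have c0 : 0 < c.
  by have := hu 0%N; rewrite mulr1; apply: lt_le_trans; rewrite normr_gt0.
have [n] : exists n, 2^-1 ^+ n < `|u| / c.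
  by apply: expr2V_lt; rewrite divr_gt0 ?normr_gt0.
rewrite ltr_pdivlMr// mulrC => /lt_le_trans /(_ (hu n)).
by rewrite ltxx.
Qed.

(* [1 - y] is the square root of [1 - h], and [y = (h + y ^ 2) / 2] is a
   contractive fixed point equation on the ball of radius [1 / 2]. *)
Lemma sqrt_cone_sub h : cstar h = h -> `|h| <= 4^-1 ->
  exists c, cone - h = cmul (cstar c) c.
Proof.
move=> hh h4; pose F z : B := 2^-1 *: (h + cmul z z).
pose y n := iter n F 0.
have n2 : `|2^-1| = 2^-1 :> R[i] by rewrite ger0_norm.
have FB u v : `|F u - F v| <= 2^-1 * ((`|u| + `|v|) * `|u - v|).
  rewrite /F -scalerBr normrZ n2 ler_pM2l ?invr_gt0// opprD addrACA subrr add0r.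
  have -> : cmul u u - cmul v v = cmul u (u - v) + cmul (u - v) v.
    by rewrite cmulBr cmulBl addrA subrK.
  rewrite (le_trans (ler_normD _ _))//.
  rewrite (le_trans (lerD (cnormM _ _) (cnormM _ _)))//.
  by rewrite [X in _ + X]mulrC -mulrDl.
have half2 : 2^-1 + 2^-1 = 1 :> R[i] by rewrite -mulr2n -[LHS]mulr_natr mulVf.
have y2 n : `|y n| <= 2^-1.
  elim: n => [|n IH]; first by rewrite normr0 invr_ge0.
  rewrite /y iterS -/(y n) normrZ n2 -[leRHS]mulr1 ler_pM2l ?invr_gt0//.
  rewrite (le_trans (ler_normD _ _))//.
  have : `|cmul (y n) (y n)| <= 2^-1 * 2^-1.
    by rewrite (le_trans (cnormM _ _))// ler_pM.
  move=> /(lerD h4)/le_trans; apply.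
  have -> : 4^-1 = 2^-1 * 2^-1 :> R[i] by rewrite -invfM -natrM.
  by rewrite -mulrDl half2 mul1r invf_le1// ler1n.
have [l hl] : exists l, forall n, `|l - y n| <= 3 * 2^-1 ^+ n.
  apply: geometric_cvg; elim=> [|n IH].
    by rewrite /= subr0 (le_trans (y2 1%N))// invf_le1// ler1n.
  rewrite exprS (le_trans (FB _ _))// ler_pM2l ?invr_gt0//.
  rewrite -[leRHS]mul1r ler_pM// ?addr_ge0// -half2.
  exact: lerD (y2 n.+1) (y2 n).
have l2 : `|l| <= 3 by have := hl 0%N; rewrite subr0 mulr1.
have lF : l = F l.
  apply/eqP; rewrite -subr_eq0; apply/eqP.
  (* The first summand bounds the distance from [l] to [y n.+1]. The second is the estimate [FB]
     between [y n] and [l], with norms at most [1 / 2] and [3]. *)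
  apply: (@small_eq0 _ _ (3 * 2^-1 + 2^-1 * ((2^-1 + 3) * 3))) => n.
  rewrite -(subrKA (y n.+1)) (le_trans (ler_normD _ _))// mulrDl lerD//.
    by rewrite (le_trans (hl _))// exprS mulrA.
  rewrite (le_trans (FB _ _))// -mulrA ler_pM2l ?invr_gt0// -mulrA.
  rewrite ler_pM// ?addr_ge0//; last by rewrite distrC.
  exact: lerD (y2 n) l2.
have ls : cstar l = l.
  apply/eqP; rewrite -subr_eq0; apply/eqP.
  have yS n : cstar (y n) = y n.
    elim: n => [|n IH].
      by rewrite /= -[X in cstar X](subrr 0) cstarB subrr.
    by rewrite /y iterS -/(y n) cstarZ cstarD cstarM IH hh geC0_conj ?invr_ge0.
  apply: (@small_eq0 _ _ (3 + 3)) => n.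
  rewrite -(subrKA (y n)) (le_trans (ler_normD _ _))//.
  rewrite -[X in `|_ - X| + _](yS n) -cstarB norm_cstar [X in _ + X]distrC.
  by rewrite (le_trans (lerD (hl _) (hl _)))// -mulrDl.
exists (cone - l); rewrite cstarB ls cstar1 cmulBl !cmulBr !cmul1a cmula1.
have -> : h = l + l - cmul l l.
  by apply/eqP; rewrite eq_sym subr_eq -mulr2n -scaler_nat {1}lF scalerA divff// scale1r.
by rewrite -(addrA l) opprD addrA.
Qed.

Lemma stateE (phi : state B) : states (phi : B -> R[i]).
Proof. exact: set_mem (valP phi). Qed.

Lemma state1 (phi : state B) : phi cone = 1.
Proof. by have [] := stateE phi. Qed.

Lemma state_ge0 (phi : state B) a : 0 <= phi (cmul (cstar a) a).
Proof. by have [] := stateE phi. Qed.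

Lemma stateDZ (phi : state B) c a b : phi (c *: a + b) = c * phi a + phi b.
Proof. by have [+ _ _] := stateE phi; apply. Qed.

Lemma stateD (phi : state B) a b : phi (a + b) = phi a + phi b.
Proof. by rewrite -[X in phi (X + b)]scale1r stateDZ mul1r. Qed.

Lemma state0 (phi : state B) : phi 0 = 0.
Proof. by have := stateD phi 0 0; rewrite addr0 => /eqP; rewrite -subr_eq0 opprD addrA subrr sub0r oppr_eq0 => /eqP. Qed.

Lemma stateZ (phi : state B) c a : phi (c *: a) = c * phi a.
Proof. by rewrite -[c *: a]addr0 stateDZ state0 addr0. Qed.

Lemma stateN (phi : state B) a : phi (- a) = - phi a.
Proof. by rewrite -scaleN1r stateZ mulN1r. Qed.

Lemma stateB (phi : state B) a b : phi (a - b) = phi a - phi b.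
Proof. by rewrite stateD stateN. Qed.

(** Both [cone - h] and [cone + h] are squares, so [phi] is nonnegative on them. Nonnegativity in
    [R[i]] includes being real, hence [phi h] is real and lies between [-1] and [1]. *)
Lemma state_selfadjoint_small (phi : state B) h :
  cstar h = h -> `|h| <= 4^-1 -> `|phi h| <= 1.
Proof.
have le1 k : cstar k = k -> `|k| <= 4^-1 -> phi k <= 1.
  move=> kk /(sqrt_cone_sub kk)[c hc].
  by rewrite -subr_ge0 -(state1 phi) -stateB hc state_ge0.
move=> hh h4; have hN : phi (- h) <= 1.
  apply: le1; last by rewrite normrN.
  by rewrite -scaleN1r cstarZ rmorphN1 hh.
rewrite real_ler_norml; first by rewrite le1// lerNl -stateN hN.
by rewrite -[phi h](subKr 1) rpredB// ger0_real// subr_ge0 le1.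
Qed.

Lemma state_selfadjoint_bound (phi : state B) h :
  cstar h = h -> `|phi h| <= 4 * `|h|.
Proof.
move=> hh; have [->|h0] := eqVneq h 0; first by rewrite state0 !normr0 mulr0.
have n0 : 0 < 4 * `|h| by rewrite mulr_gt0 ?normr_gt0.
have c0 : 0 <= (4 * `|h|)^-1 by rewrite invr_ge0 ltW.
have := @state_selfadjoint_small phi ((4 * `|h|)^-1 *: h).
rewrite cstarZ hh geC0_conj// normrZ normfV [`|4 * _|]gtr0_norm//.
rewrite invfM -mulrA mulVf ?normr_eq0// mulr1 lexx => /(_ erefl isT).
by rewrite -invfM stateZ normrM (ger0_norm c0) ler_pdivrMl// mulr1.
Qed.

(** Each of the selfadjoint real and imaginary parts of [a] contributes [4]. The optimal constant is
    [1]; what matters is that the bound is the same for all states. *)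
Lemma state_bound (phi : state B) a : `|phi a| <= 8 * `|a|.
Proof.
pose h1 := 2^-1 *: (a + cstar a).
pose h2 := (2^-1 * - 'i) *: (a - cstar a).
have e : a = h1 + 'i *: h2.
  rewrite /h1 /h2 scalerA mulrCA mulrN -expr2 sqrCi opprK mulr1 -scalerDr.
  by rewrite addrACA subrr addr0 -mulr2n -[a *+ 2]scaler_nat scalerA mulVf// scale1r.
have i2 : (2^-1 : R[i])^* = 2^-1 by rewrite geC0_conj ?invr_ge0.
have n2 : `|2^-1| = 2^-1 :> R[i] by rewrite ger0_norm ?invr_ge0.
have s1 : cstar h1 = h1 by rewrite cstarZ i2 cstarD cstarK addrC.
have s2 : cstar h2 = h2.
  have ci : (2^-1 * - 'i : R[i])^* = 2^-1 * 'i.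
    by rewrite rmorphM rmorphN /= conjCi opprK i2.
  by rewrite /h2 cstarZ ci cstarB cstarK mulrN scaleNr -scalerN opprB.
have b1 : `|h1| <= `|a|.
  rewrite normrZ n2 ler_pdivrMl// (le_trans (ler_normD _ _))// norm_cstar.
  by rewrite -mulr2n mulr_natl.
have b2 : `|h2| <= `|a|.
  rewrite normrZ normrM n2 normrN normCi mulr1 ler_pdivrMl//.
  by rewrite (le_trans (ler_normB _ _))// norm_cstar -mulr2n mulr_natl.
clearbody h1 h2; rewrite {1}e stateD stateZ (le_trans (ler_normD _ _))//.
have -> : `|'i * phi h2| = `|phi h2| by rewrite normrM normCi mul1r.
have -> : 8 = 4 + 4 :> R[i] by rewrite -natrD.
rewrite mulrDl lerD// (le_trans (state_selfadjoint_bound _ _))//.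
  by rewrite ler_pM2l.
by rewrite ler_pM2l.
Qed.
End CStar.

(** * Topology of the state space *)

Lemma ultra_cvg_compact (T : Type) (X : topologicalType) (F : set_system T)
  (f : T -> X) (K : set X) : UltraFilter F -> compact K ->
  (forall t, K (f t)) -> exists2 p, K p & f @ F --> p.
Proof.
move=> FU Kco fK; have FK : (f @ F) K by apply: (@filterE _ F).
have [p [Kp clp]] := Kco (f @ F) _ FK; exists p => // V Vp.
have [//|FC] := in_ultra_setVsetC (f @^-1` V) FU.
by have [x [nVx Vx]] := clp (~` V) V FC Vp.
Qed.

(** * Sign patterns and uniform continuity *)

Section SignSeparation.
Variables (R : realType) (T : topologicalType) (y : nat -> T -> R).
Hypothesis Tco : compact [set: T].
Hypothesis yc : forall i, continuous (y i).
Hypothesis ysep : forall p q : T, p <> q -> exists i, y i p * y i q < 0.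

(** The value zero agrees with both signs. This makes the relation closed for continuous [y], at the
    price of transitivity. *)
Definition same_sign n (p q : T) := forall i, (i < n)%N -> 0 <= y i p * y i q.

(** Compactness of the square: near a diagonal point [g] varies by less than [e], and near any other
    point some [y i] has opposite signs, so the hypothesis fails as soon as [n > i]. Finitely many
    such neighbourhoods yield a common [n]. *)
Lemma sign_unif_cont (g : T -> R) (e : R) : continuous g -> 0 < e ->
  exists n, forall p q, same_sign n p q -> `|g p - g q| < e.
Proof.
move=> gc e0.
have TTco : compact [set: T * T].
  by rewrite -setXTT; exact: compact_setX.
have /compact_near_coveringP/(_ nat \oo
    (fun n (pq : T * T) => same_sign n pq.1 pq.2 -> `|g pq.1 - g pq.2| < e)) := TTco.
case=> [[p q] _|n _ /(_ n (leqnn n)) h]; last first.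
  by exists n => p q; exact: (h (p, q) I).
have [<-|pq] := pselect (p = q).
  have cg : {for (p, p), continuous (fun pq : T * T => `|g pq.1 - g pq.2|)}.
    apply: cvg_norm; apply: cvgB.
      by apply: (cvg_comp _ _ cvg_fst); exact: gc.
    by apply: (cvg_comp _ _ cvg_snd); exact: gc.
  have : \forall z \near (p, p), `|g z.1 - g z.2| < e.
    by apply: (cvgr_lt _ cg); rewrite subrr normr0.
  move=> H; exists ([set z | `|g z.1 - g z.2| < e], [set: nat]) => /=.
    by split => //; exact: filterT.
  by move=> [z n] /= [? _] _.
have [i yi] := ysep pq.
have cy : {for (p, q), continuous (fun pq : T * T => y i pq.1 * y i pq.2)}.
  apply: cvgM.
    by apply: (cvg_comp _ _ cvg_fst); exact: yc.
  by apply: (cvg_comp _ _ cvg_snd); exact: yc.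
have H : \forall z \near (p, q), y i z.1 * y i z.2 < 0 by exact: (cvgr_lt _ cy).
exists ([set z | y i z.1 * y i z.2 < 0], [set n | i < n]%N) => /=.
  by split => //; exists i.+1.
by move=> [z n] /= [zi ni] /(_ i ni); rewrite leNgt zi.
Qed.

End SignSeparation.

Section StateTopology.
Variables (R : realType) (B : unitalCStarAlgType R[i]).
Implicit Types (phi psi : state B) (a b : B).

Definition re_state b phi : R := complex.Re (phi b).

Lemma ReB (u v : R[i]) : complex.Re (u - v) = complex.Re u - complex.Re v.
Proof. by case: u v => ? ? [? ?]. Qed.

Lemma ReD (u v : R[i]) : complex.Re (u + v) = complex.Re u + complex.Re v.
Proof. by case: u v => ? ? [? ?]. Qed.

Lemma ReZ (r : R) (v : R[i]) : complex.Re (r%:C%C * v) = r * complex.Re v.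
Proof. by case: v => ? ?; rewrite /= mul0r subr0. Qed.

(** This reduces every later statement to the real functions [re_state b]. *)
Lemma Im_state b phi : complex.Im (phi b) = re_state (- 'i *: b) phi.
Proof.
rewrite /re_state stateZ; case: (phi b) => u v /=.
by rewrite !(mul0r, mulN1r, oppr0, sub0r, opprK).
Qed.

Lemma re_stateB a b phi : re_state (a - b) phi = re_state a phi - re_state b phi.
Proof. by rewrite /re_state stateB ReB. Qed.

Lemma re_stateZ (r : R) a phi : re_state (r%:C%C *: a) phi = r * re_state a phi.
Proof. by rewrite /re_state stateZ ReZ. Qed.

Lemma re_state1 phi : re_state cone phi = 1.
Proof. by rewrite /re_state state1. Qed.

Lemma ler_Re_norm (u : R[i]) : `|complex.Re u| <= complex.Re `|u|.
Proof.
have : (`|complex.Re u|)%:C%C <= `|u| :> R[i] by rewrite normc_ge_Re.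
by rewrite lecE /= => /andP[].
Qed.

Lemma re_state_bound b phi : `|re_state b phi| <= complex.Re (8 * `|b|).
Proof.
apply: le_trans (ler_Re_norm _) _.
by have := state_bound phi b; rewrite lecE => /andP[].
Qed.

Lemma re_state_ext phi psi : (forall b, re_state b phi = re_state b psi) -> phi = psi.
Proof.
move=> h; apply: state_ext => b.
have := h b; have := h (- 'i *: b); rewrite -!Im_state /re_state.
by case: (phi b) (psi b) => ? ? [? ?] /= -> ->.
Qed.

Lemma Re_continuous : continuous (fun z : R[i]^o => complex.Re z).
Proof.
move=> z; apply/(@cvgrPdist_lt _ _ _ _ (@nbhs_filter R[i]^o z)) => e e0.
have e0' : 0 < e%:C%C :> R[i] by rewrite ltcR.
apply: filterS (@nbhsx_ballx _ R[i]^o z _ e0') => w; rewrite -ball_normE /= => zw.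
rewrite -ReB; apply: le_lt_trans (ler_Re_norm _) _.
by move: zw; rewrite ltcE /= => /andP[].
Qed.

Lemma eval_state_continuous b : continuous (fun phi : state B => phi b : R[i]^o).
Proof.
move=> phi; apply: (@continuous_comp (state B) {ptws B -> R[i]^o} R[i]^o set_val (fun f => f b)).
  exact: initial_continuous.
exact: (@proj_continuous B (fun=> R[i]^o) b).
Qed.

Lemma re_state_continuous b : continuous (re_state b).
Proof.
move=> phi; apply: (@continuous_comp _ R[i]^o _ (fun phi : state B => phi b)).
  exact: eval_state_continuous.
exact: Re_continuous.
Qed.

Lemma ler_norm_Re_Im (u : R[i]) :
  `|u| <= (`|complex.Re u| + `|complex.Im u|)%:C%C.
Proof.
rewrite {1}[u]complexE rmorphD /= (le_trans (ler_normD _ _))//.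
rewrite normrM normCi mul1r !normc_def /= !expr0n /= !addr0 !sqrtr_sqr.
by rewrite lexx.
Qed.

Lemma cvg_Re_Im (T : Type) (F : set_system T) (f : T -> R[i]^o) (l : R[i]^o) :
  Filter F -> (fun t => complex.Re (f t)) @ F --> complex.Re l ->
  (fun t => complex.Im (f t)) @ F --> complex.Im l -> f @ F --> l.
Proof.
move=> FF fr fi; apply/cvgrPdist_lt => e e0.
have [r r0 re] : exists2 r : R, 0 < r & e = r%:C%C.
  exists (complex.Re e); first by have := e0; rewrite ltcE => /andP[].
  by case: e e0 => a b; rewrite ltcE /= => /andP[/eqP -> _].
have r20 : 0 < r / 2 by rewrite divr_gt0.
near=> t.
have h1 : `|complex.Re l - complex.Re (f t)| < r / 2.
  by near: t; move/cvgrPdist_lt : fr; apply.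
have h2 : `|complex.Im l - complex.Im (f t)| < r / 2.
  by near: t; move/cvgrPdist_lt : fi; apply.
apply: le_lt_trans (ler_norm_Re_Im _) _; rewrite !raddfB /= re ltcR [ltRHS]splitr.
by rewrite ltrD.
Unshelve. all: end_near. Qed.

Lemma state_cvgP (T : Type) (F : set_system T) (f : T -> state B) phi : Filter F ->
  (forall b, (fun t => re_state b (f t)) @ F --> re_state b phi) -> f @ F --> phi.
Proof.
move=> FF h U; rewrite /nbhs /= => -[V [/= [W oW <-] Wphi] VU].
have : {ptws, (fun t => set_val (f t)) @ F --> (set_val phi : B -> R[i]^o)}.
  apply/pointwise_cvgP => b; apply: cvg_Re_Im; first exact: h.
  have := h (- 'i *: b); rewrite -Im_state.
  by under eq_fun do rewrite -Im_state.
move=> /(_ W) Wn; apply: (@filterS _ F _ [set t | W (set_val (f t))]).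
  by move=> t Wt; exact: VU.
by apply: Wn; exact: open_nbhs_nbhs.
Qed.

(** The Banach-Alaoglu argument: along an ultrafilter each [re_state b] converges, because its
    values stay in a compact interval, and the limits assemble to a state. *)
Lemma state_compact : compact [set: state B].
Proof.
rewrite compact_ultra => F FU _.
have cvgb b : exists l : R, re_state b @ F --> l.
  pose M := complex.Re (8 * `|b|).
  have [] := @ultra_cvg_compact _ _ F (re_state b) `[- M, M] FU.
  - exact: segment_compact.
  - by move=> phi; rewrite /= in_itv /= -ler_norml re_state_bound.
  - by move=> l _ h; exists l.
have [l hl] := choice cvgb.
pose g b : R[i] := (l b +i* l (- 'i *: b))%C.
have hg b : (fun phi : state B => phi b) @ F --> (g b : R[i]^o).
  apply: cvg_Re_Im => /=; first exact: hl.
  under eq_fun do rewrite Im_state; exact: hl.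
have uniq (f : state B -> R[i]^o) (u v : R[i]^o) : f @ F --> u -> f @ F --> v -> u = v.
  by move=> fu fv; apply: (cvg_unique _ fu fv); exact: norm_hausdorff.
have uniqR (f : state B -> R) (u v : R) : f @ F --> u -> f @ F --> v -> u = v.
  by move=> fu fv; apply: (cvg_unique _ fu fv); exact: Rhausdorff.
have gs : g \in @states R B.
  apply/mem_set; split=> [c a b|a|].
  - apply: (uniq (fun phi => phi (c *: a + b))); first exact: hg.
    under eq_fun do rewrite stateDZ.
    apply: (@cvgD _ R[i]^o); last exact: hg.
    by apply: (@cvgZr _ R[i]^o); exact: hg.
  - have Ig : complex.Im (g (cmul (cstar a) a)) = 0.
      apply: (uniqR _ _ _ (hl _)).
      rewrite (_ : re_state _ = fun=> 0); first exact: cvg_cst.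
      apply/funext => phi; rewrite -Im_state.
      by have := state_ge0 phi a; rewrite lecE /= => /andP[/eqP].
    have Rg : 0 <= complex.Re (g (cmul (cstar a) a)).
      rewrite /=; apply: (cvgr_to_ge (hl (cmul (cstar a) a))).
      by apply: nearW => phi; have := state_ge0 phi a; rewrite lecE => /andP[].
    by rewrite lecE Ig eqxx.
  - apply: (uniq (fun phi => phi cone)); first exact: hg.
    by under eq_fun do rewrite state1; exact: cvg_cst.
exists (exist (fun f => f \in @states R B) g gs); split=> //.
have := @state_cvgP _ F id (exist (fun f => f \in @states R B) g gs) _.
rewrite /= => /(_ _) h; apply: h => b; exact: hl.
Qed.

Lemma state_hausdorff : hausdorff_space (state B).
Proof.
move=> phi psi cl; apply: re_state_ext => b; apply: (@Rhausdorff R) => U V Up Vp.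
have [z [Uz Vz]] := cl _ _ (re_state_continuous Up) (re_state_continuous Vp).
by exists (re_state b z).
Qed.

(* Signs suffice: a multiple of the unit can be subtracted from an element that
   separates two states. *)
Lemma separable_sign_separation : separable B -> exists d : nat -> B,
  forall phi psi, phi <> psi -> exists i, re_state (d i) phi < 0 < re_state (d i) psi.
Proof.
move=> [D Dc Dd].
have [x Dx] : D !=set0.
  by have [x [_ Dx]] := Dd setT ltac:(by exists 0) openT; exists x.
have [d dD] : exists d : nat -> B, forall b, D b -> exists i, d i = b.
  have /countable_injP[f finj] := Dc.
  exists (fun i => xget x [set b | D b /\ f b = i]) => b Db; exists (f b).
  have [Dz fz] := @xgetPex _ x [set b' | D b' /\ f b' = f b] (ex_intro _ b (conj Db erefl)).
  by apply: finj; rewrite ?inE.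
exists d => phi psi phipsi.
have [a ha] : exists a, re_state a phi < 0 < re_state a psi.
  have [a] : exists a, re_state a phi <> re_state a psi.
    apply: contrapT => h; apply: phipsi; apply: re_state_ext => b.
    by apply: contrapT => nb; apply: h; exists b.
  pose r := (re_state a phi + re_state a psi) / 2.
  move=> ne; have [lt|gt|//] := ltgtP (re_state a phi) (re_state a psi).
    exists (a - r%:C%C *: cone).
    by rewrite !re_stateB !re_stateZ !re_state1 /r; apply/andP; split; lra.
  exists (r%:C%C *: cone - a).
  by rewrite !re_stateB !re_stateZ !re_state1 /r; apply/andP; split; lra.
(* By [state_bound] states are norm continuous, so the sign condition met by [a] holds on an open
   set, which the dense set meets. *)
have cont omega : continuous (fun b : B => re_state b omega).
  move=> b; apply: (@continuous_comp _ R[i]^o _ (fun b => omega b)); last exact: Re_continuous.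
  apply/cvgrPdist_lt => e e0; near=> c; rewrite -stateB.
  apply: le_lt_trans (state_bound _ _) _; rewrite -ltr_pdivlMl//.
  near: c; have e8 : 0 < 8^-1 * e by rewrite mulr_gt0 ?invr_gt0.
  by apply: filterS (@nbhsx_ballx _ B b _ e8) => c; rewrite -ball_normE.
have oU : open [set b | re_state b phi < 0 < re_state b psi].
  have -> : [set b | re_state b phi < 0 < re_state b psi] =
     [set b | re_state b phi < 0] `&` [set b | 0 < re_state b psi].
    by apply/seteqP; split=> b /= => [/andP[]|[-> ->]].
  apply: openI.
    apply: (@open_comp _ _ (fun b => re_state b phi) [set r | r < 0]) => [? _|]; first exact: cont.
    exact: open_lt.
  apply: (@open_comp _ _ (fun b => re_state b psi) [set r | 0 < r]) => [? _|]; first exact: cont.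
  exact: open_gt.
have [b [bU Db]] := Dd _ (ex_intro _ a ha) oU.
by have [i di] := dD b Db; exists i; rewrite di.
Unshelve. all: end_near. Qed.

End StateTopology.

(** * Discretization of measures *)

Section WeightedPoints.
Context {R : realType} {T : Type}.
Implicit Types (D : seq (R * T)) (g h : T -> R).

(** A list of weighted points stands for a finitely supported measure, and [wsum] is the integral
    against it. *)
Definition wsum D g : R := \sum_(wp <- D) wp.1 * g wp.2.

Definition prob_weights D := all (fun wp => 0 <= wp.1) D /\ wsum D (fun=> 1) = 1.

Lemma wsum_cons a D g : wsum (a :: D) g = a.1 * g a.2 + wsum D g.
Proof. by rewrite /wsum big_cons. Qed.

Lemma wsumD D g h : wsum D (fun p => g p + h p) = wsum D g + wsum D h.
Proof. by rewrite /wsum -big_split; apply: eq_bigr => wp _; rewrite mulrDr. Qed.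

Lemma wsumB D g h : wsum D (fun p => g p - h p) = wsum D g - wsum D h.
Proof. by rewrite /wsum -sumrB; apply: eq_bigr => wp _; rewrite mulrBr. Qed.

Lemma wsumZ D c g : wsum D (fun p => c * g p) = c * wsum D g.
Proof. by rewrite /wsum big_distrr; apply: eq_bigr => wp _; rewrite mulrCA. Qed.

Lemma eq_wsum D g h : g =1 h -> wsum D g = wsum D h.
Proof. by move=> gh; apply: eq_bigr => wp _; rewrite gh. Qed.

Lemma ler_wsum D g h : all (fun wp => 0 <= wp.1) D -> (forall p, g p <= h p) ->
  wsum D g <= wsum D h.
Proof.
move=> + gh; elim: D => [|a D IH]; first by rewrite /wsum !big_nil.
by rewrite !wsum_cons /= => /andP[a0 /IH]; apply: lerD; exact: ler_wpM2l.
Qed.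

Lemma wsum_ge0 D g : all (fun wp => 0 <= wp.1) D -> (forall p, 0 <= g p) -> 0 <= wsum D g.
Proof.
move=> D0 /(ler_wsum D0); apply: le_trans.
by rewrite /wsum big1// => i _; rewrite mulr0.
Qed.

Lemma wsum_cst D c : prob_weights D -> wsum D (fun=> c) = c.
Proof.
by move=> [_ D1]; rewrite -[RHS]mulr1 -D1 -wsumZ; apply: eq_wsum => p; rewrite mulr1.
Qed.

Lemma wsum_dist D g h (e : R) : prob_weights D -> (forall p, `|g p - h p| <= e) ->
  `|wsum D g - wsum D h| <= e.
Proof.
move=> Dp gh; have [D0 _] := Dp.
have h1 p : - e <= g p - h p by have := gh p; rewrite ler_norml => /andP[].
have h2 p : g p - h p <= e by have := gh p; rewrite ler_norml => /andP[].
rewrite -wsumB ler_norml -{1}(wsum_cst (- e) Dp) -{2}(wsum_cst e Dp).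
by rewrite !ler_wsum.
Qed.

End WeightedPoints.

Section Discretization.
Context d (T : measurableType d) (R : realType) (P : probability T R).
Implicit Types g : T -> R.

Lemma bounded_integrable g (M : R) : measurable_fun setT g -> (forall x, `|g x| <= M) ->
  P.-integrable setT (EFin \o g).
Proof.
move=> mg gM; apply: measurable_bounded_integrable => //.
  by rewrite /= probability_setT ltry.
exists M; split; first exact: num_real.
by move=> x Mx t _; exact: le_trans (gM t) (ltW Mx).
Qed.

Lemma fine_probability_gt0 (A : set T) : measurable A -> P A <> 0%E -> 0 < fine (P A).
Proof.
move=> mA PA; apply: fine_gt0; rewrite lt_neqAle eq_sym measure_ge0 andbT.
by rewrite -ge0_fin_numE// fin_num_measure// andbT; apply/eqP.
Qed.

Variables (I : finType) (c : T -> I).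
Hypothesis mc : forall i, measurable (c @^-1` [set i]).

Lemma measurable_code (G : I -> R) : measurable_fun setT (G \o c).
Proof.
move=> _ Y mY; rewrite setTI.
have -> : (G \o c) @^-1` Y = \bigcup_(i in [set i | Y (G i)]) (c @^-1` [set i]).
  by apply/seteqP; split=> [x /= Yx|x [i /= Yi ci]]; [exists (c x)|rewrite /= ci].
by apply: fin_bigcup_measurable => //; exact: finite_finset.
Qed.

Lemma code_bound (G : I -> R) : exists M : R, forall x, `|G (c x)| <= M.
Proof.
exists (\sum_i `|G i|) => x; rewrite (bigD1 (c x))//= lerDl.
by apply: sumr_ge0.
Qed.

Lemma Rintegral_code (G : I -> R) :
  \int[P]_x G (c x) = \sum_i fine (P (c @^-1` [set i])) * G i.
Proof.
have [M hM] := code_bound G.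
rewrite /Rintegral.
have -> : [set: T] = \big[setU/set0]_(i <- index_enum I) (c @^-1` [set i]).
  apply/seteqP; split=> // x _; rewrite -bigcup_seq.
  by exists (c x) => //=; rewrite mem_index_enum.
rewrite integral_bigsetU_EFin//; last 3 first.
- exact: index_enum_uniq.
- by move=> i j _ _ [x [/= <- <-]].
- apply/measurable_EFinP; apply: measurable_funTS; exact: measurable_code.
rewrite (eq_bigr (fun i => (fine (P (c @^-1` [set i])) * G i)%:E)); last first.
  move=> i _; rewrite (eq_integral (fun=> (G i)%:E)); last first.
    by move=> x; rewrite inE /= => ->.
  by rewrite integral_cst// EFinM fineK ?fin_num_measure//= muleC.
by rewrite sumEFin.
Qed.

Lemma code_approx g (G : I -> R) (M e : R) : measurable_fun setT g ->
  (forall x, `|g x| <= M) -> (forall x, `|g x - G (c x)| <= e) ->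
  `|\int[P]_x g x - \sum_i fine (P (c @^-1` [set i])) * G i| <= e.
Proof.
move=> mg gM gG; have [N hN] := code_bound G.
have ig := bounded_integrable mg gM.
have iG : P.-integrable setT (EFin \o (G \o c)).
  by apply: (@bounded_integrable _ N) => //; exact: measurable_code.
rewrite -Rintegral_code -RintegralB//.
apply: (le_trans (le_normr_Rintegral _ _)) => //.
  exact: (integrableB measurableT ig iG).
have -> : e = \int[P]_(x in setT) e.
  by rewrite Rintegral_cst//= probability_setT mulr1.
apply: le_Rintegral => //.
- have : P.-integrable setT (EFin \o (g \- (G \o c))).
    exact: (integrableB measurableT ig iG).
  by move/integrable_norm.
- exact: finite_measure_integrable_cst.
Qed.

(** The mass of each cell of [c] is moved to one point of the cell, which changes the integral by at
    most the oscillation of [g] on the cells. *)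
Lemma code_discretization (x0 : T) : exists2 D : seq (R * T), prob_weights D &
  forall g (M e : R), measurable_fun setT g -> (forall x, `|g x| <= M) ->
    (forall x x', c x = c x' -> `|g x - g x'| <= e) ->
    `|\int[P]_x g x - wsum D g| <= e.
Proof.
(* An empty cell receives the default point [x0], with weight zero. *)
pose D := [seq (fine (P (c @^-1` [set i])), xget x0 (c @^-1` [set i])) | i <- index_enum I].
have H g (M e : R) : measurable_fun setT g -> (forall x, `|g x| <= M) ->
    (forall x x', c x = c x' -> `|g x - g x'| <= e) ->
    `|\int[P]_x g x - wsum D g| <= e.
  move=> mg gM ge; rewrite /wsum big_map.
  apply: (code_approx (G := fun i => g (xget x0 (c @^-1` [set i]))) mg gM) => x.
  apply: ge; symmetry.
  exact: (@xgetPex _ x0 (c @^-1` [set c x]) (ex_intro _ x erefl)).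
exists D => //; split.
  by apply/allP => _ /mapP[i _ ->] /=; rewrite fine_ge0.
(* The estimate for the constant [1] with error [0] says that the weights sum to [1]. *)
have := H (fun=> 1) 1 0 (measurable_cst _); rewrite normr1 subrr normr0.
move=> /(_ (fun=> lexx _) (fun _ _ _ => lexx _)).
rewrite normr_le0 subr_eq0 => /eqP <-.
by rewrite Rintegral_cst//= probability_setT mulr1.
Qed.

End Discretization.

(** * Limits of finitely supported measures *)

Section Coding.
Variables (R : realType) (T : topologicalType) (y : nat -> T -> R).
Hypothesis Tco : compact [set: T].
Hypothesis yc : forall i, continuous (y i).
Hypothesis ysep : forall p q : T, p <> q -> exists i, y i p * y i q < 0.

(* The first [n] signs, the most recent one first. *)
Fixpoint sign_code n (p : T) : seq bool :=
  if n is m.+1 then (y m p < 0) :: sign_code m p else [::].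

Lemma size_sign_code n p : size (sign_code n p) = n.
Proof. by elim: n => //= n ->. Qed.

(** The points with code [s] need not form a closed set, since [y m p < 0] is strict. Weak
    inequalities give a closed set that contains them and on which signs still agree. The head of a
    code belongs to the index [size s']. *)
Fixpoint sign_hull (s : seq bool) : set T :=
  if s is b :: s' then
    sign_hull s' `&` [set p | if b then y (size s') p <= 0 else 0 <= y (size s') p]
  else setT.

Lemma sign_hull_closed s : closed (sign_hull s).
Proof.
elim: s => [|b s IH] /=; first exact: closedT.
apply: closedI => //; case: b.
  by apply: (@closed_comp _ _ (y (size s)) [set r | r <= 0]) => [? _|]; [exact: yc|exact: closed_le].
by apply: (@closed_comp _ _ (y (size s)) [set r | 0 <= r]) => [? _|]; [exact: yc|exact: closed_ge].
Qed.

Lemma sign_hull_code n p : sign_hull (sign_code n p) p.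
Proof.
elim: n => //= n IH; split => //; rewrite size_sign_code.
by case: ltP => // /ltW.
Qed.

Lemma sign_hull_same_sign s p q : sign_hull s p -> sign_hull s q ->
  same_sign y (size s) p q.
Proof.
elim: s => [|b s IH] //= [ps pb] [qs qb] i; rewrite ltnS leq_eqVlt => /predU1P[->|].
  by case: b pb qb => pb qb; [exact: mulr_le0|exact: mulr_ge0].
exact: IH.
Qed.

Lemma sign_code_same_sign n p q : sign_code n p = sign_code n q -> same_sign y n p q.
Proof.
move=> pq; have := @sign_hull_same_sign (sign_code n p) p q.
by rewrite size_sign_code; apply; [|rewrite pq]; exact: sign_hull_code.
Qed.

(** Cantor's intersection theorem relative to [U]; the case [U = set0] shows that a decreasing
    sequence of nonempty closed sets has a common point. *)
Lemma decreasing_closed_cover (C : nat -> set T) (U : set T) :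
  (forall n, closed (C n)) -> (forall n, C n.+1 `<=` C n) -> open U ->
  \bigcap_n C n `<=` U -> exists n, C n `<=` U.
Proof.
move=> Cc Cd oU CU.
have Cle n m : (n <= m)%N -> C m `<=` C n.
  by move/subnKC <-; elim: (m - n)%N => [|k IH]; rewrite ?addn0// addnS => p /Cd/IH.
have /compact_near_coveringP/(_ nat \oo (fun n p => C n p -> U p)) := Tco.
case=> [p _|n _ /(_ n (leqnn n)) h]; last by exists n => p; exact: (h p I).
have [Up|nUp] := pselect (U p).
  exists (U, [set: nat]) => /=; last by move=> [q n] /= [].
  by split; [exact: open_nbhs_nbhs|exact: filterT].
have [n nCp] : exists n, ~ C n p.
  apply: contrapT => /forallNP h; apply: nUp; apply: CU => n _.
  exact: contrapT (h n).
exists (~` C n, [set m | n <= m]%N) => /=; last first.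
  by move=> [q m] /= [nCq nm] /(Cle _ _ nm).
split; last by exists n.
by apply: open_nbhs_nbhs; split => //; exact: closed_openC.
Qed.

End Coding.

Section BorelStates.
Variables (R : realType) (B : unitalCStarAlgType R[i]) (phi0 : state B).

Lemma state_fun_bounded (g : state B -> R) : continuous g ->
  exists M : R, forall p, `|g p| <= M.
Proof.
move=> gc; have : compact (g @` setT).
  by apply: continuous_compact; [exact: continuous_subspaceT|exact: state_compact].
move=> /compact_bounded[M [_ /(_ (M + 1))]]; rewrite ltrDl ltr01 => /(_ isT) h.
by exists (M + 1) => p; apply: h; exists p.
Qed.

Lemma open_borel (U : set (state B)) : open U -> measurable (U : set (borel_state phi0)).
Proof. exact: sub_sigma_algebra. Qed.

Lemma continuous_borel (g : state B -> R) : continuous g ->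
  measurable_fun setT (g : borel_state phi0 -> R).
Proof.
move=> gc; apply: (@measurability _ _ _ _ _ _ _ (RGenOpens.measurableE R)) => //.
move=> _ [_ [a [b ->]] <-]; rewrite setTI; apply: open_borel.
by apply: open_comp => [p _|]; [exact: gc|exact: interval_open].
Qed.

End BorelStates.

Section LimitMeasure.
Variables (R : realType) (B : unitalCStarAlgType R[i]) (d : nat -> B).
Variable phi0 : state B.
Let y i := @re_state R B (d i).
Hypothesis ysep : forall p q : state B, p <> q -> exists i, y i p * y i q < 0.
Let yc i : continuous (y i). Proof. exact: re_state_continuous. Qed.

Variables (J : Type) (F : set_system J) (D : J -> seq (R * state B)).
Context {FU : UltraFilter F}.
Hypothesis Dprob : forall j, prob_weights (D j).

Let mass j (s : seq bool) := wsum (D j) (fun p => (sign_code y (size s) p == s)%:R).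

Let mass_cvg s : exists l : R, mass^~ s @ F --> l.
Proof.
have [] := @ultra_cvg_compact _ _ F (mass^~ s) `[0, 1] FU.
- exact: segment_compact.
- move=> j; have [D0 D1] := Dprob j; rewrite /= in_itv /=; apply/andP; split.
    by apply: wsum_ge0 => // p; rewrite ler0n.
  by rewrite -D1; apply: ler_wsum => // p; case: eqP.
- by move=> l _ h; exists l.
Qed.

(** Limit masses of the codes. Mass may move to the boundary of a cell in the limit, so [Q s] need
    not be the mass of the cell of [s] under the limit measure; this is why [X] below is built from
    hulls. *)
Let Q s := sval (cid (mass_cvg s)).

Let massQ s : mass^~ s @ F --> Q s.
Proof. exact: svalP (cid (mass_cvg s)). Qed.

Let Q_ge0 s : 0 <= Q s.
Proof.
apply: (cvgr_to_ge (@massQ s)); apply: nearW => j.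
by apply: wsum_ge0 => [|p]; [have [] := Dprob j|rewrite ler0n].
Qed.

Let Q_nil : Q [::] = 1.
Proof.
apply: (cvg_unique _ (@massQ [::])); first exact: Rhausdorff.
rewrite (_ : mass^~ [::] = fun=> 1); first exact: cvg_cst.
by apply/funext => j; have [_ <-] := Dprob j; exact: eq_wsum.
Qed.

Let Q_cons s : Q (true :: s) + Q (false :: s) = Q s.
Proof.
apply: (cvg_unique _ (cvgD (@massQ (true :: s)) (@massQ (false :: s)))).
  exact: Rhausdorff.
rewrite (_ : mass^~ _ + mass^~ _ = mass^~ s); first exact: massQ.
apply/funext => j; rewrite -[LHS]/(mass j (true :: s) + mass j (false :: s)).
rewrite /mass -wsumD; apply: eq_wsum => p /=.
by rewrite !eqseq_cons; case: (y _ p < 0); case: eqP; rewrite ?addr0 ?add0r.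
Qed.

(** A code that no point has gets mass zero from every [D j], hence also in the limit. *)
Let Q_gt0 s : 0 < Q s -> exists p, sign_code y (size s) p = s.
Proof.
move=> Qs; apply: contrapT => /forallNP h; move: Qs.
suff -> : Q s = 0 by rewrite ltxx.
apply: (cvg_unique _ (@massQ s)); first exact: Rhausdorff.
rewrite (_ : mass^~ s = fun=> 0); first exact: cvg_cst.
apply/funext => j; rewrite -[RHS](wsum_cst 0 (Dprob j)); apply: eq_wsum => p.
by case: eqP => // /h.
Qed.

(* The code [s] is given the half-open subinterval of [0, 1) that starts at
   [left s] and has length [Q s]. *)
Fixpoint left (s : seq bool) : R :=
  if s is b :: s' then left s' + (if b then 0 else Q (true :: s')) else 0.

Let left_cons b s : left s <= left (b :: s) /\
  left (b :: s) + Q (b :: s) <= left s + Q s.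
Proof.
rewrite -(Q_cons s) /=; case: b.
  by rewrite !addr0 lerD2l lerDl Q_ge0.
by rewrite lerDl Q_ge0 -addrA.
Qed.

Let left_bounds s : 0 <= left s /\ left s + Q s <= 1.
Proof.
elim: s => [|b s [IH1 IH2]]; first by rewrite /= add0r Q_nil.
have [h1 h2] := left_cons b s.
by split; [exact: le_trans h1|exact: le_trans h2 IH2].
Qed.

(** Reals outside [[0, 1)], in particular the endpoint [1] of the uniform law, are read as [0], so
    that every real has a code. *)
Let clamp (t : R) : R := if (0 <= t) && (t < 1) then t else 0.

Fixpoint itv_code n (t : R) : seq bool :=
  if n is m.+1 then
    (clamp t < left (itv_code m t) + Q (true :: itv_code m t)) :: itv_code m t
  else [::].

Let size_itv_code n t : size (itv_code n t) = n.
Proof. by elim: n => //= n ->. Qed.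

Let itv_codeP n t : left (itv_code n t) <= clamp t < left (itv_code n t) + Q (itv_code n t).
Proof.
elim: n => [|n /andP[IH1 IH2]].
  by rewrite /= Q_nil add0r /clamp; case: ifP => //; rewrite lexx ltr01.
rewrite [itv_code _ _]/=; case: ltP => h /=.
  by rewrite addr0 IH1.
by rewrite h -addrA Q_cons.
Qed.

Let itv_code_uniq s t : left s <= clamp t < left s + Q s -> itv_code (size s) t = s.
Proof.
elim: s => [|b s IH] //= /andP[h1 h2].
have [l1 l2] := left_cons b s.
have -> : itv_code (size s) t = s.
  by apply: IH; rewrite (le_trans l1 h1) (lt_le_trans h2 l2).
congr (_ :: _); case: b h1 h2 {l1 l2} => /=.
  by rewrite addr0 => _ ->.
by move=> h1 h2; apply/negbTE; rewrite -leNgt.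
Qed.

Let measurable_clamp : measurable_fun setT clamp.
Proof.
apply: measurable_fun_if => //.
by apply: measurable_and => //; [exact: measurable_fun_ler|exact: measurable_fun_ltr].
Qed.

Let measurable_itv_code n s : measurable [set t : R | itv_code n t = s].
Proof.
elim: n s => [|n IH] [|b s] /=.
- by rewrite (_ : [set _ | _] = setT)//; apply/seteqP; split.
- by rewrite (_ : [set _ | _] = set0)//; apply/seteqP; split.
- by rewrite (_ : [set _ | _] = set0)//; apply/seteqP; split.
have -> : [set t : R | (clamp t < left (itv_code n t) + Q (true :: itv_code n t)) :: itv_code n t = b :: s]
   = [set t | itv_code n t = s] `&` (fun t => clamp t < left s + Q (true :: s)) @^-1` [set b].
  by apply/seteqP; split=> t /= [] => [<- <-|-> <-].
apply: measurableI => //; rewrite -[X in measurable X]setTI.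
by apply: measurable_fun_ltr => //; exact: measurable_cst.
Qed.

Let measurable_itv_code_pred n (A : set (seq bool)) :
  measurable [set t : R | A (itv_code n t)].
Proof.
rewrite (_ : [set _ | _] = \bigcup_(s in A) [set t : R | itv_code n t = s]).
  rewrite bigcup_mkcond; apply: countable_bigcupT_measurable => // s.
  by case: ifPn.
by apply/seteqP; split=> [t /= At|t [s As /= ->]//]; exists (itv_code n t).
Qed.

Let U01 : probability (measurableTypeR R) R := uniform_prob (@ltr01 R).

(** The uniform law lives on [[0, 1]], whereas the intervals of the codes tile [[0, 1)]; the
    endpoint is a null set. *)
Let uniform_itv (A : set R) : measurable A -> U01 A = lebesgue_measure (A `&` `[0, 1[).
Proof.
move=> mA.
have mC : measurable (A `&` `[0, 1]) by apply: measurableI.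
have -> : U01 A = lebesgue_measure (A `&` `[0, 1]).
  rewrite /U01 /= /uniform_prob integral_uniform_pdf.
  rewrite (eq_integral (fun=> 1%:E)); last first.
    move=> t; rewrite inE /= in_itv /= => -[_ t01].
    by rewrite /uniform_pdf t01 subr0 invr1.
  by rewrite integral_cst// mul1e.
have -> : A `&` `[0, 1] = (A `&` `[0, 1[) `|` (A `&` [set (1 : R)]).
  rewrite -setIUr; congr (_ `&` _); apply/seteqP; split=> t /=.
    by rewrite !in_itv /= => /andP[-> /=]; rewrite le_eqVlt => /predU1P[->|]; [right|left].
  by rewrite !in_itv /= => -[/andP[-> /ltW]//|->]; rewrite ler01 lexx.
apply: measureU0.
- by apply: measurableI.
- by apply: measurableI.
- apply/eqP; rewrite eq_le measure_ge0 andbT -(lebesgue_measure_set1 (1 : R)).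
  by apply: le_measure; rewrite ?inE//; exact: measurableI.
Qed.

Let measure_itv_code s : fine (U01 [set t : R | itv_code (size s) t = s]) = Q s.
Proof.
rewrite uniform_itv//.
have [l0 l1] := left_bounds s.
have -> : [set t : R | itv_code (size s) t = s] `&` `[0, 1[ = `[left s, left s + Q s[%classic.
  apply/seteqP; split=> t /=; rewrite !in_itv /=.
    by move=> [ts t01]; have := itv_codeP (size s) t; rewrite ts /clamp t01.
  move=> /andP[h1 h2].
  have t01 : (0 <= t) && (t < 1) by rewrite (le_trans l0 h1) (lt_le_trans h2 l1).
  by split=> //; apply: itv_code_uniq; rewrite /clamp t01 h1 h2.
rewrite lebesgue_measure_itv /= lte_fin; case: ifPn => [_|].
  by rewrite -EFinD /= addrAC subrr add0r.
rewrite ltrDl -leNgt /= => Q0; have := Q_ge0 s => Q0'.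
by apply/eqP; rewrite eq_le Q0 Q0'.
Qed.

(** The codes of [t] determine decreasing closed hulls whose intersection is a single point:
    [X_hull] shows that it is nonempty, so the default [phi0] is harmless, and sign separation gives
    uniqueness. *)
Let X (t : R) : state B := xget phi0 (\bigcap_n sign_hull y (itv_code n t)).

Let itv_code_Q n t : 0 < Q (itv_code n t).
Proof.
have /andP[h1 h2] := itv_codeP n t.
by have := le_lt_trans h1 h2; rewrite ltrDl.
Qed.

Let Tco := @state_compact R B.

Let X_hull n t : sign_hull y (itv_code n t) (X t).
Proof.
have [p] : \bigcap_n sign_hull y (itv_code n t) !=set0.
  apply/set0P/eqP => h0 {n}.
  have [||||n hn] := @decreasing_closed_cover _ Tco
    (fun n => sign_hull y (itv_code n t)) set0.
  - by move=> m; exact: sign_hull_closed.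
  - by move=> m p [].
  - exact: open0.
  - by rewrite h0.
  have [p hp] := Q_gt0 (itv_code_Q n t).
  by apply: (hn p); rewrite -hp; exact: sign_hull_code.
by move=> hp; exact: (@xgetPex _ phi0 (\bigcap_n sign_hull y (itv_code n t)) (ex_intro _ p hp) n I).
Qed.

(** As the hulls shrink to the point [X t], one of them is already inside an open set that contains
    it. The right side is a countable union of events about finitely many signs, hence [X] is
    Borel. *)
Let X_preimage (U : set (state B)) : open U ->
  X @^-1` U = \bigcup_n [set t : R | sign_hull y (itv_code n t) `<=` U].
Proof.
move=> oU; apply/seteqP; split=> [t /= Ut|t [n _ /= hn]]; last exact/hn/X_hull.
have [||||n hn] := @decreasing_closed_cover _ Tco
    (fun n => sign_hull y (itv_code n t)) U.
- by move=> m; exact: sign_hull_closed.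
- by move=> m p [].
- exact: oU.
- move=> p hp; suff -> : p = X t by [].
  apply: contrapT => pX; have [i yi] := ysep pX; move: yi; apply/negP; rewrite -leNgt.
  have := @sign_hull_same_sign _ _ y (itv_code i.+1 t) p (X t) (hp _ I) (X_hull _ _).
  by rewrite size_itv_code; apply.
by exists n.
Qed.

Let measurable_X : measurable_fun setT (X : measurableTypeR R -> borel_state phi0).
Proof.
apply: (@measurability _ _ _ (borel_state phi0) setT _ (@open (state B))) => //.
move=> _ [U oU <-]; rewrite setTI X_preimage//.
apply: bigcupT_measurable => n.
exact: (@measurable_itv_code_pred n [set s | sign_hull y s `<=` U]).
Qed.

Let XM : {mfun measurableTypeR R >-> borel_state phi0} :=
  mfun_Sub (mem_set measurable_X).

Let nu : probability (borel_state phi0) R := distribution U01 XM.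


Let pt (s : seq bool) : state B := xget phi0 [set p | sign_code y (size s) p = s].

Let pt_code p s : sign_code y (size s) p = s -> sign_code y (size s) (pt s) = s.
Proof. by move=> ps; exact: (@xgetPex _ phi0 [set p | sign_code y (size s) p = s] (ex_intro _ p ps)). Qed.

Let wsum_code n j (G : seq bool -> R) :
  wsum (D j) (fun p => G (sign_code y n p)) = \sum_(s : n.-tuple bool) mass j s * G s.
Proof.
rewrite /mass /wsum; under [RHS]eq_bigr do rewrite size_tuple big_distrl /=.
rewrite exchange_big /=; apply: eq_bigr => -[w p] _ /=.
rewrite (bigD1 (Tuple (introT eqP (size_sign_code y n p))))//= eqxx mulr1.
rewrite big1 ?addr0// => s /eqP sp; case: eqP => [ps|_]; last by rewrite mulr0 mul0r.
by exfalso; apply: sp; exact/val_inj.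
Qed.

(* This takes the place of the Riesz representation theorem: the measure is the
   law of [X] for the uniform distribution on [0, 1]. *)
Lemma limit_measure : exists mu : probability (borel_state phi0) R,
  forall g : state B -> R, continuous g ->
    (fun j => wsum (D j) g) @ F --> \int[mu]_p g p.
Proof.
exists nu => g gc.
have [M gM] := state_fun_bounded gc.
have mgX : measurable_fun setT (g \o X : measurableTypeR R -> R).
  exact: (measurableT_comp (continuous_borel gc) measurable_X).
have -> : \int[nu]_p g p = \int[U01]_t g (X t).
  rewrite /Rintegral (integral_distribution (X := XM))//.
    by apply/measurable_EFinP; exact: continuous_borel.
  by apply: (@bounded_integrable _ _ _ U01 (g \o X) M) => // t; exact: gM.
apply/cvgrPdist_le => e e0; have e3 : 0 < e / 3 by rewrite divr_gt0.
have [n hn] := sign_unif_cont Tco yc ysep gc e3.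
(* Both integrals are compared with sums over the codes of length [n] with the same values [G s].
   The two sums differ only in the masses, which converge for each of the finitely many codes. *)
pose G (s : seq bool) := g (pt s).
pose c t : n.-tuple bool := Tuple (introT eqP (size_itv_code n t)).
have cE (s : n.-tuple bool) : c @^-1` [set s] = [set t : R | itv_code (size s) t = s].
  rewrite size_tuple; apply/seteqP; split=> t /= => [<-//|ts].
  exact/val_inj.
have mc (s : n.-tuple bool) : measurable (c @^-1` [set s] : set (measurableTypeR R)).
  by rewrite cE; exact: measurable_itv_code.
have A1 : `|\int[U01]_t g (X t) - \sum_(s : n.-tuple bool) Q s * G s| <= e / 3.
  have := @code_approx _ _ _ U01 _ c mc (g \o X) (fun s : n.-tuple bool => G s) M (e / 3) mgX.
  under eq_bigr do rewrite cE measure_itv_code.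
  apply=> t; first exact: gM.
  apply/ltW/hn; have [p hp] := Q_gt0 (itv_code_Q n t).
  have := @sign_hull_same_sign _ _ y (itv_code n t) (X t) (pt (itv_code n t)) (X_hull _ _).
  rewrite size_itv_code; apply.
  by rewrite -{1}(pt_code hp); exact: sign_hull_code.
have A2 j : `|wsum (D j) g - \sum_(s : n.-tuple bool) mass j s * G s| <= e / 3.
  rewrite -wsum_code; apply: wsum_dist => // p; apply/ltW/hn.
  apply: sign_code_same_sign; symmetry.
  by have := @pt_code p (sign_code y n p); rewrite size_sign_code; exact.
have A3 : (fun j => \sum_(s : n.-tuple bool) mass j s * G s) @ F --> \sum_(s : n.-tuple bool) Q s * G s.
  apply: cvg_big => [|s _]; first exact: add_continuous.
  by apply: cvgMl; exact: massQ.
move/cvgrPdist_le : A3 => /(_ _ e3); apply: filterS => j A3.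
have := A2 j; rewrite distrC => A2'.
rewrite -(subrKA (\sum_(s : n.-tuple bool) Q s * G s)) (le_trans (ler_normD _ _))//.
rewrite -(subrKA (\sum_(s : n.-tuple bool) mass j s * G s) (\sum_(s : n.-tuple bool) Q s * G s)).
have -> : e = e / 3 + (e / 3 + e / 3) by field.
by rewrite lerD// (le_trans (ler_normD _ _))// lerD.
Qed.

End LimitMeasure.

(** * Maximal states of closed convex relations *)

Section ClosedRelations.
Variables (R : realType) (B : unitalCStarAlgType R[i]).
Local Open Scope convex_scope.
Implicit Types (phi psi omega : state B) (C : set (state B * state B)).

Lemma re_state_conv (t : {i01 R}) phi psi b :
  re_state b (phi <| t |> psi) = t%:num * re_state b phi + (1 - t%:num) * re_state b psi.
Proof. by rewrite /re_state -!ReZ -ReD. Qed.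

Lemma re_state_ge0 a phi : 0 <= re_state (cmul (cstar a) a) phi.
Proof. by have := state_ge0 phi a; rewrite lecE => /andP[]. Qed.

Lemma state_conv_weights (w v : R) : 0 <= w -> 0 < v ->
  exists t : {i01 R}, forall phi psi b,
    (w + v) * re_state b (phi <| t |> psi) = w * re_state b phi + v * re_state b psi.
Proof.
move=> w0 v0; have wv0 : 0 < w + v by rewrite ltr_wpDl.
have t0 : 0 <= w / (w + v) by rewrite divr_ge0// ltW.
have t1 : w / (w + v) <= 1 by rewrite ler_pdivrMr// mul1r lerDl ltW.
exists (Itv01 t0 t1) => phi' psi' b; rewrite re_state_conv /=.
by field; rewrite gt_eqF.
Qed.

Lemma wsum_weight0 (T : Type) (D : seq (R * T)) g : all (fun wp => 0 <= wp.1) D ->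
  wsum D (fun=> 1) = 0 -> wsum D g = 0.
Proof.
elim: D => [|[w p] D IH] /=; first by rewrite /wsum !big_nil.
move=> /andP[w0 D0]; rewrite !wsum_cons /= mulr1 => /eqP.
rewrite paddr_eq0//; last exact: wsum_ge0.
by move=> /andP[/eqP -> /eqP /(IH D0) ->]; rewrite mul0r addr0.
Qed.

(** A finite Jensen argument: the barycenter of [D] is related to the barycenter of its image under
    [sel], for an arbitrary choice [sel] of related points. *)
Lemma convex_wsum C D (sel : state B -> state B) : convex_order C -> prob_weights D ->
  (forall p, C (p, sel p)) ->
  exists phi psi, [/\ C (phi, psi), (forall b, re_state b phi = wsum D (re_state b)) &
    forall b, re_state b psi = wsum D (re_state b \o sel)].
Proof.
move=> Cconv [D0 D1] Csel.
(* Multiplying by the total weight lets the induction run over lists that are not normalized. *)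
suff : exists phi psi, [/\ C (phi, psi),
    (forall b, wsum D (fun=> 1) * re_state b phi = wsum D (re_state b)) &
    forall b, wsum D (fun=> 1) * re_state b psi = wsum D (re_state b \o sel)].
  move=> [phi [psi [h1 h2 h3]]]; exists phi, psi; split => // b.
    by rewrite -h2 D1 mul1r.
  by rewrite -h3 D1 mul1r.
have : wsum D (fun=> 1) != 0 by rewrite D1 oner_neq0.
elim: D D0 {D1} => [|[w p] D IH] /=; first by rewrite /wsum big_nil eqxx.
move=> /andP[/= w0 D0] _.
have [W0|W0] := eqVneq (wsum D (fun=> 1)) 0.
  exists p, (sel p); split => // b; rewrite !wsum_cons /= W0 !mulr1 addr0.
    by rewrite (wsum_weight0 (re_state b) D0 W0) addr0.
  by rewrite (wsum_weight0 (re_state b \o sel) D0 W0) addr0.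
have [phi [psi [h1 h2 h3]]] := IH D0 W0.
have Wp : 0 < wsum D (fun=> 1) by rewrite lt_neqAle eq_sym W0 wsum_ge0.
have [t ht] := state_conv_weights w0 Wp.
exists (p <| t |> phi), (sel p <| t |> psi); split => [|b|b].
- exact: (Cconv t (p, sel p) (phi, psi)).
- by rewrite !wsum_cons /= mulr1 ht h2.
- by rewrite !wsum_cons /= mulr1 ht h3.
Qed.

Lemma barycenter D : prob_weights D ->
  exists phi : state B, forall b, re_state b phi = wsum D (re_state b).
Proof.
move=> Dp; have [phi [_ [_ h _]]] := @convex_wsum setT D id (fun _ _ _ _ _ => I) Dp (fun _ => I).
by exists phi.
Qed.

(** The projection is a continuous image of a compact set in a Hausdorff space. *)
Lemma closed_proj C : closed C -> closed [set phi | exists psi, C (phi, psi)].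
Proof.
move=> Cc; have -> : [set phi | exists psi, C (phi, psi)] = fst @` C.
  by apply/seteqP; split=> [phi [psi h]|_ [[phi psi] h <-]]; [exists (phi, psi)|exists psi].
apply: compact_closed; first exact: state_hausdorff.
apply: continuous_compact.
  by apply: continuous_subspaceT => p; exact: cvg_fst.
apply: (@subclosed_compact _ _ setT) => //.
by rewrite -setXTT; apply: compact_setX; exact: state_compact.
Qed.

Lemma closed_state_cvg (A : set (state B)) (u : nat -> state B) phi : closed A ->
  (forall n, A (u n)) -> (forall b, (fun n => re_state b (u n)) @ \oo --> re_state b phi) -> A phi.
Proof.
move=> Ac Au ucvg; apply: (@closed_cvg _ _ \oo _ u A Ac) => //; first by exists 0%N.
exact: state_cvgP.
Qed.

Lemma closed_re_le (f g : state B * state B -> R) : continuous f -> continuous g ->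
  closed [set p | f p <= g p].
Proof.
move=> fc gc.
have -> : [set p | f p <= g p] = (fun p => g p - f p) @^-1` [set r | 0 <= r].
  by apply/seteqP; split=> p /=; rewrite subr_ge0.
apply: closed_comp; last exact: closed_ge.
by move=> p _; apply: cvgB; [exact: gc|exact: fc].
Qed.

Lemma re_fst_continuous b : continuous (fun p : state B * state B => re_state b p.1).
Proof. by move=> p; apply: (cvg_comp _ _ cvg_fst); exact: re_state_continuous. Qed.

Lemma re_snd_continuous b : continuous (fun p : state B * state B => re_state b p.2).
Proof. by move=> p; apply: (cvg_comp _ _ cvg_snd); exact: re_state_continuous. Qed.

Definition gap_rel C b (e : R) : set (state B * state B) :=
  C `&` [set p | re_state b p.1 + e <= re_state b p.2].

Definition gap C b e : set (state B) := [set phi | exists psi, gap_rel C b e (phi, psi)].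

Lemma closed_gap_rel C b e : closed C -> closed (gap_rel C b e).
Proof.
move=> Cc; apply: closedI => //; apply: closed_re_le; last exact: re_snd_continuous.
by move=> p; apply: cvgD; [exact: re_fst_continuous|exact: cvg_cst].
Qed.

Lemma closed_gap C b e : closed C -> closed (gap C b e).
Proof. by move=> Cc; apply: closed_proj; exact: closed_gap_rel. Qed.

Lemma closed_borel phi0 (A : set (state B)) : closed A -> measurable (A : set (borel_state phi0)).
Proof.
move=> Ac; rewrite -[A]setCK; apply: measurableC.
by apply: open_borel; exact: closed_openC.
Qed.

Variable d : nat -> B.
Hypothesis dsep : forall phi psi, phi <> psi ->
  exists i, re_state (d i) phi < 0 < re_state (d i) psi.

Lemma sep_gap phi psi : phi <> psi ->
  exists i n, re_state (d i) phi + n.+1%:R^-1 <= re_state (d i) psi.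
Proof.
move=> /dsep[i /andP[h1 h2]]; exists i.
have [n hn] : exists n, n.+1%:R^-1 < re_state (d i) psi.
  by have [n _ hn] := near_infty_natSinv_lt (PosNum h2); exists n; exact: (hn n (leqnn n)).
by exists n; rewrite -[leRHS]add0r lerD// ltW.
Qed.

Lemma not_maximal C : (forall phi, C (phi, phi)) ->
  ~` maximal C = \bigcup_i \bigcup_n gap C (d i) n.+1%:R^-1.
Proof.
move=> Cr; apply/seteqP; split=> phi.
  move=> /existsNP[psi /not_implyP[Cpp ne]].
  have [i [n h]] := sep_gap (fun e : phi = psi => ne (esym e)).
  by exists i => //; exists n => //; exists psi.
move=> [i _ [n _ [psi [/= Cpp h]]]] /(_ psi Cpp) e; move: h.
by rewrite e gerDl leNgt invr_gt0 ltr0n.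
Qed.

Lemma maximal_borel phi0 C : closed C -> (forall phi, C (phi, phi)) ->
  measurable (maximal C : set (borel_state phi0)).
Proof.
move=> Cc Cr; rewrite -[maximal C]setCK; apply: measurableC; rewrite not_maximal//.
apply: bigcupT_measurable => i; apply: bigcupT_measurable => n.
by apply: closed_borel; exact: closed_gap.
Qed.

Lemma concentrated_maximal phi (mu : probability (borel_state phi) R) C :
  closed C -> (forall phi, C (phi, phi)) ->
  (forall i n, mu (gap C (d i) n.+1%:R^-1) = 0%E) -> concentrated mu (maximal C).
Proof.
move=> Cc Cr h; rewrite /concentrated not_maximal//.
apply: negligible_bigcup => i; apply: negligible_bigcup => n.
apply/negligibleP; last exact: h.
by apply: closed_borel; exact: closed_gap.
Qed.

Section Representation.
Variables (phi0 : state B) (mu : probability (borel_state phi0) R).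

Lemma integral_continuous (g : state B -> R) : continuous g ->
  (\int[mu]_p (g p)%:E = (\int[mu]_p g p)%:E)%E.
Proof.
move=> gc; have [M gM] := state_fun_bounded gc.
rewrite /Rintegral fineK//; apply: integrable_fin_num => //.
by apply: (@bounded_integrable _ _ _ mu g M) => //; exact: continuous_borel.
Qed.

(** The cells record the first [n] signs and also membership in [K]. The indicator of [K] is
    therefore constant on cells and its integral is exact at every stage, while integrals of
    continuous functions converge by [sign_unif_cont]. *)
Lemma discretization (K : set (state B)) : measurable (K : set (borel_state phi0)) ->
  exists D : nat -> seq (R * state B),
  [/\ forall n, prob_weights (D n),
      forall n, wsum (D n) (fun p => (p \in K)%:R) = fine (mu K) &
      forall g : state B -> R, continuous g -> (fun n => wsum (D n) g) @ \oo --> \int[mu]_p g p].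
Proof.
move=> mK; pose y i := @re_state R B (d i).
have yc i : continuous (y i) by exact: re_state_continuous.
have ysep (p q : state B) : p <> q -> exists i, y i p * y i q < 0.
  by move=> /dsep[i /andP[h1 h2]]; exists i; rewrite nmulr_rlt0.
pose c n p : n.-tuple bool * bool := (Tuple (introT eqP (size_sign_code y n p)), p \in K).
have msc n s : measurable ([set p | sign_code y n p = s] : set (borel_state phi0)).
  elim: n s => [|n IH] [|b s] /=.
  - by rewrite (_ : [set _ | _] = setT)//; apply/seteqP; split.
  - by rewrite (_ : [set _ | _] = set0)//; apply/seteqP; split.
  - by rewrite (_ : [set _ | _] = set0)//; apply/seteqP; split.
  have -> : [set p | (y n p < 0) :: sign_code y n p = b :: s] =
      [set p | sign_code y n p = s] `&` (fun p => y n p < 0) @^-1` [set b].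
    by apply/seteqP; split=> p /= [] => [<- <-|-> <-].
  apply: measurableI => //; rewrite -[X in measurable X]setTI.
  by apply: measurable_fun_ltr => //; exact: continuous_borel.
have mc n (i : n.-tuple bool * bool) : measurable (c n @^-1` [set i] : set (borel_state phi0)).
  case: i => s b.
  have -> : c n @^-1` [set (s, b)] = [set p | sign_code y n p = s] `&` (if b then K else ~` K).
    apply/seteqP; split=> p /=.
      move=> [<- <-]; split => //; case: ifPn => [|/negP h]; first by rewrite inE.
      by move=> Kp; apply: h; rewrite inE.
    move=> [ps Kb]; congr (_, _); first exact/val_inj.
    by case: b Kb => Kb; [exact/mem_set|exact/memNset].
  by apply: measurableI => //; case: b => //; exact: measurableC.
have H n := code_discretization mu (mc n) phi0.
pose D n := s2val (cid2 (H n)); pose Dp n := s2valP (cid2 (H n)).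
pose De n := s2valP' (cid2 (H n)).
exists D; split => [n|n|g gc]; first exact: Dp.
  have mi : measurable_fun setT (fun p : borel_state phi0 => (p \in K)%:R : R).
    exact: (measurable_indic (D := setT) mK).
  have := De n (fun p => (p \in K)%:R) 1 0 mi.
  have -> : \int[mu]_p ((p : borel_state phi0) \in K)%:R = fine (mu K).
    rewrite /Rintegral -[in RHS](setIT (K : set (borel_state phi0))).
    by rewrite -(integral_indic mu measurableT).
  move=> h; have {}h : `|fine (mu K) - wsum (D n) (fun p => (p \in K)%:R)| <= 0.
    apply: h => [p|p q [_ ->]]; last by rewrite subrr normr0.
    by case: (p \in K); rewrite ?normr1 ?normr0.
  by move: h; rewrite normr_le0 subr_eq0 => /eqP <-.
have [M gM] := state_fun_bounded gc.
apply/cvgrPdist_le => e e0.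
have [n0 hn0] := sign_unif_cont (@state_compact R B) yc ysep gc e0.
exists n0 => // n /= n0n.
apply: (De n g M e) => //; first exact: continuous_borel.
move=> p q [pq _]; apply/ltW/hn0 => i ii0.
by apply: (sign_code_same_sign pq); exact: leq_trans n0n.
Qed.

End Representation.

Lemma representsP phi (mu : probability (borel_state phi) R) :
  represents phi mu <-> forall b, \int[mu]_p re_state b p = re_state b phi.
Proof.
split=> h b.
  have [h1 _] := h b; rewrite /Rintegral.
  by rewrite [X in fine X]h1.
split; first by rewrite -[RHS]/((re_state b phi)%:E) -h -integral_continuous//; exact: re_state_continuous.
under eq_integral do rewrite Im_state.
rewrite Im_state -h -integral_continuous//; exact: re_state_continuous.
Qed.

Lemma mu_gap0 phi (mu : probability (borel_state phi) R) C i n :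
  closed C -> convex_order C -> (forall phi, C (phi, phi)) -> maximal C phi ->
  represents phi mu -> mu (gap C (d i) n.+1%:R^-1) = 0%E.
Proof.
move=> Cc Cconv Cr Cmax /representsP rep.
set e := n.+1%:R^-1; set K := gap C (d i) e.
have e0 : 0 < e by rewrite invr_gt0.
have mK : measurable (K : set (borel_state phi)) by apply: closed_borel; exact: closed_gap.
apply: contrapT => muK.
have t0 : 0 < fine (mu K) by exact: fine_probability_gt0.
have [D [Dp DK Dcvg]] := discretization mu mK.
(* Points of [K] move up by at least [e]; all others stay, by reflexivity. *)
have /choice[sel hsel] (p : state B) : exists q, C (p, q) /\
    re_state (d i) p + e * (p \in K)%:R <= re_state (d i) q.
  have [|pK] := boolP (p \in K).
    by move=> /set_mem[q [h1 h2]]; exists q; rewrite mulr1.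
  by exists p; rewrite mulr0 addr0.
(* On average the gain is at least [e * mu K], whatever [n'] is. One closed set thus contains all
   the approximate barycenters and hence their limit [phi]. *)
have /choice[u hu] n' : exists u : state B, gap C (d i) (e * fine (mu K)) u /\
    forall b, re_state b u = wsum (D n') (re_state b).
  have [u [v [h1 h2 h3]]] := convex_wsum Cconv (Dp n') (fun p => (hsel p).1).
  exists u; split => //; exists v; split => //=.
  rewrite h2 h3 -(DK n') -wsumZ -wsumD; apply: ler_wsum => [|p]; first by have [] := Dp n'.
  exact: (hsel p).2.
have : gap C (d i) (e * fine (mu K)) phi.
  apply: (closed_state_cvg (u := u)) => [|k|b].
  - exact: closed_gap.
  - by have [] := hu k.
  - rewrite -rep; under eq_fun do rewrite (hu _).2.
    by apply: Dcvg; exact: re_state_continuous.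
move=> [psi [/= /Cmax -> ]]; rewrite gerDl leNgt => /negP; apply.
by rewrite mulr_gt0.
Qed.

Lemma maximal_concentrated phi (mu : probability (borel_state phi) R) C :
  closed C -> convex_order C -> (forall phi, C (phi, phi)) -> maximal C phi ->
  represents phi mu -> concentrated mu (maximal C).
Proof. by move=> Cc Cconv Cr Cmax rep; apply: concentrated_maximal => // i n; exact: mu_gap0. Qed.

End ClosedRelations.

(** * Pure states *)

Section PureStates.
Variables (R : realType) (B : unitalCStarAlgType R[i]).
Local Open Scope convex_scope.
Implicit Types (phi psi omega : state B).

(* [psi] is a summand of [phi] with weight at least [t]. *)
Definition minorant (t : R) : set (state B * state B) :=
  [set p | forall a, t * re_state (cmul (cstar a) a) p.2 <= re_state (cmul (cstar a) a) p.1].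

Lemma minorant_complement (t : R) phi psi : t < 1 -> minorant t (phi, psi) ->
  exists psi2, forall b, re_state b phi = t * re_state b psi + (1 - t) * re_state b psi2.
Proof.
move=> t1 h; have t10 : 0 < 1 - t by rewrite subr_gt0.
pose g b : R[i] := (1 - t)^-1%:C%C * (phi b - t%:C%C * psi b).
have gs : g \in @states R B.
  apply/mem_set; split=> [c a b|a|].
  - by rewrite /g !stateDZ; ring.
  - rewrite /g mulr_ge0 ?ler0c ?invr_ge0 ?(ltW t10)// subr_ge0.
    (* The hypothesis compares real parts only; positivity of both states makes the imaginary parts
       vanish. *)
    move: (h a) (state_ge0 phi a) (state_ge0 psi a); rewrite /re_state /=.
    case: (phi _) (psi _) => [x x'] [z z']; rewrite !lecE /=.
    by move=> xz /andP[/eqP -> _] /andP[/eqP -> _]; rewrite !(mulr0, mul0r) addr0 subr0 xz eqxx.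
  - rewrite /g !state1 mulr1 -[X in _ * (X - _)](rmorph1 (real_complex R)) -rmorphB /=.
    by rewrite -rmorphM /= mulVf ?gt_eqF.
exists (exist (fun f => f \in @states R B) g gs : state B) => b.
have -> : re_state b (exist (fun f => f \in @states R B) g gs : state B) =
    (1 - t)^-1 * (re_state b phi - t * re_state b psi).
  by rewrite {1}/re_state /evals /= /g ReZ ReB ReZ.
by field; rewrite gt_eqF.
Qed.

Lemma pure_minorant (t : R) phi psi : 0 < t -> pure B phi -> minorant t (phi, psi) -> psi = phi.
Proof.
(* A smaller weight keeps [psi] a minorant, and a weight below [1] leaves room for the complementary
   state. *)
move=> t0 pphi h; pose s := Num.min t 2^-1.
have s0 : 0 < s by rewrite lt_min t0 invr_gt0 ltr0n.
have s1 : s < 1 by rewrite gt_min invf_lt1 ?ltr1n ?orbT.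
have hs : minorant s (phi, psi).
  move=> a; apply: le_trans (h a); rewrite ler_wpM2r ?re_state_ge0//.
  by rewrite ge_min lexx.
have [psi2 e] := minorant_complement s1 hs.
have pe : phi = psi <| Itv01 (ltW s0) (ltW s1) |> psi2.
  by apply: re_state_ext => b; rewrite re_state_conv e.
by have [] := pphi (Itv01 (ltW s0) (ltW s1)) psi psi2 s0 s1 pe.
Qed.

(** One fixed weight has to detect all decompositions, because a relation that only asks for some
    positive weight need not be closed. *)
Lemma pureE : pure B = maximal (minorant 2^-1).
Proof.
apply/seteqP; split=> phi.
  by move=> pphi psi; apply: pure_minorant => //; rewrite invr_gt0.
move=> phimax t psi1 psi2 t0 t1 e.
have eb b : re_state b phi = t%:num * re_state b psi1 + (1 - t%:num) * re_state b psi2.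
  by rewrite e re_state_conv.
(* The weight [t] of [psi1] may be below one half. But [t psi1 <= phi] and [(1 - t) phi <= phi] add
   up to a mixture dominated by [2 phi], to which maximality applies. *)
have e1 : psi1 <| t |> phi = phi.
  apply: phimax => a /=; rewrite re_state_conv.
  have := re_state_ge0 a psi1; have := re_state_ge0 a psi2; rewrite eb.
  set x := re_state _ psi1; set z := re_state _ psi2; move: t0 t1.
  set u := t%:num => u0 u1 z0 x0.
  have zu : 0 <= (1 - u) * z by rewrite mulr_ge0// subr_ge0 ltW.
  have xu : 0 <= u * x by rewrite mulr_ge0// ltW.
  have : u * (u * x + (1 - u) * z) >= 0 by rewrite mulr_ge0 ?addr_ge0// ltW.
  by lra.
have psi1E : psi1 = phi.
  apply: re_state_ext => b; have := congr1 (re_state b) e1; rewrite re_state_conv.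
  move=> h; apply: (@mulfI _ t%:num); first by rewrite gt_eqF.
  by lra.
split=> //; apply: re_state_ext => b; have := eb b; rewrite psi1E => h.
apply: (@mulfI _ (1 - t%:num)); first by rewrite gt_eqF// subr_gt0.
by lra.
Qed.

Lemma minorant_closed t : closed (minorant t).
Proof.
have -> : minorant t = \bigcap_a [set p | t * re_state (cmul (cstar a) a) p.2 <=
    re_state (cmul (cstar a) a) p.1].
  by apply/seteqP; split=> p h a; [move=> _; exact: h|exact: h].
apply: closed_bigI => a _; apply: closed_re_le; last exact: re_fst_continuous.
by move=> p; apply: cvgMr; exact: re_snd_continuous.
Qed.

Lemma minorant_refl t phi : t <= 1 -> minorant t (phi, phi).
Proof. by move=> t1 a /=; rewrite ler_piMl ?re_state_ge0. Qed.

Let half_le1 : 2^-1 <= 1 :> R.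
Proof. by rewrite invf_le1 ?ler1n. Qed.

Variable d : nat -> B.
Hypothesis dsep : forall phi psi, phi <> psi ->
  exists i, re_state (d i) phi < 0 < re_state (d i) psi.

Lemma pure_borel phi0 : measurable (pure B : set (borel_state phi0)).
Proof.
rewrite pureE; apply: (maximal_borel dsep); first exact: minorant_closed.
by move=> phi; exact: minorant_refl.
Qed.

(** If [mu] charged a closed half-space [K i n] that misses [phi], the barycenter of [mu]
    conditioned on it would be a state in the half-space and a minorant of [phi] with weight
    [mu (K i n)], hence equal to [phi] by purity. *)
Lemma pure_represents_set1 phi (mu : probability (borel_state phi) R) :
  pure B phi -> represents phi mu -> concentrated mu [set phi].
Proof.
move=> pphi /representsP rep.
pose K i n := [set omega | re_state (d i) phi + n.+1%:R^-1 <= re_state (d i) omega].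
have cK i n : closed (K i n).
  by apply: (@closed_comp _ _ (re_state (d i)) [set r | _ <= r]) => [? _|];
    [exact: re_state_continuous|exact: closed_ge].
rewrite /concentrated.
have -> : ~` [set phi] = \bigcup_i \bigcup_n K i n.
  apply/seteqP; split=> omega.
    move=> /= ne; have [i [n h]] := sep_gap dsep (fun e => ne (esym e)).
    by exists i => //; exists n.
  move=> [i _ [n _ h]] /= e; move: h; rewrite /K /= e gerDl leNgt.
  by rewrite invr_gt0 ltr0n.
apply: negligible_bigcup => i; apply: negligible_bigcup => n.
have mK : measurable (K i n : set (borel_state phi)) by exact: closed_borel.
apply/negligibleP => //; apply: contrapT => muK.
set t := fine (mu (K i n)).
have t0 : 0 < t by exact: fine_probability_gt0.
have [D [Dp DK Dcvg]] := discretization dsep mu mK.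
(* The density of the conditioned measure. The mass of [K i n] being exact under [D m], the
   reweighted list [D' m] has total weight [1]. *)
pose w p := t^-1 * (p \in K i n)%:R : R.
have w0 p : 0 <= w p by apply: mulr_ge0; rewrite ?invr_ge0 ?ler0n// ltW.
pose D' m := [seq (wp.1 * w wp.2, wp.2) | wp <- D m].
have D'E m g : wsum (D' m) g = wsum (D m) (fun p => w p * g p).
  by rewrite /wsum big_map; apply: eq_bigr => wp _; rewrite mulrA.
have Dp' m : prob_weights (D' m).
  split.
    rewrite all_map; have [+ _] := Dp m; apply: sub_all => wp /= wp0.
    by rewrite mulr_ge0.
  rewrite D'E (eq_wsum _ (h := w)); last by move=> p; rewrite mulr1.
  by rewrite wsumZ DK mulVf ?gt_eqF.
have Cc : closed (minorant t `&` [set p | K i n p.2]).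
  apply: closedI; first exact: minorant_closed.
  by apply: (@closed_comp _ _ snd (K i n)) => // p _; exact: cvg_snd.
have /choice[u hu] m : exists u : state B,
    (exists psi, (minorant t `&` [set p | K i n p.2]) (u, psi)) /\
    forall b, re_state b u = wsum (D m) (re_state b).
  have [u hu] := barycenter (Dp m); have [v hv] := barycenter (Dp' m).
  exists u; split => //; exists v; split => [a|] /=; rewrite /K /= ?hu hv D'E.
    rewrite -wsumZ; apply: ler_wsum => [|p]; first by have [] := Dp m.
    rewrite mulrA /w mulVKf ?gt_eqF//.
    by case: (p \in _); rewrite ?mul1r// mul0r re_state_ge0.
  have -> : re_state (d i) phi + n.+1%:R^-1 =
      wsum (D m) (fun p => (re_state (d i) phi + n.+1%:R^-1) * w p).
    by rewrite wsumZ wsumZ DK mulVf ?gt_eqF// mulr1.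
  apply: ler_wsum => [|p]; first by have [] := Dp m.
  rewrite mulrC /w; have [/set_mem pK|_] := boolP (p \in K i n).
    by rewrite mulr1 ler_wpM2l// invr_ge0 ltW.
  by rewrite mulr0 !mul0r.
have [psi [/= h1 h2]] : exists psi, (minorant t `&` [set p | K i n p.2]) (phi, psi).
  apply: (closed_state_cvg (u := u)) (closed_proj Cc) _ _ => [k|b].
    by have [] := hu k.
  rewrite -rep; under eq_fun do rewrite (hu _).2.
  by apply: Dcvg; exact: re_state_continuous.
move: h2; rewrite /K /= (pure_minorant t0 pphi h1) gerDl leNgt.
by rewrite invr_gt0 ltr0n.
Qed.

End PureStates.

(** * Representing measures *)

Section Choquet.
Variables (R : realType) (B : unitalCStarAlgType R[i]).
Local Open Scope convex_scope.
Implicit Types (phi psi omega : state B).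
Variable d : nat -> B.
Hypothesis dsep : forall phi psi, phi <> psi ->
  exists i, re_state (d i) phi < 0 < re_state (d i) psi.

Let M i : R := complex.Re (8 * `|d i|).
(** [M i] bounds the [i]-th function on all states, so this factor makes the term [u phi i] at most
    [2^-1 ^+ i]. *)
Let c i : R := 2^-1 ^+ i / (1 + M i ^+ 2).
Let u phi i := c i * re_state (d i) phi ^+ 2.

Let half_gt0 : 0 < 2^-1 :> R. Proof. by rewrite invr_gt0. Qed.

Let c_gt0 i : 0 < c i.
Proof. by rewrite divr_gt0 ?exprn_gt0// ltr_pwDl// sqr_ge0. Qed.

Let u_ge0 phi i : 0 <= u phi i.
Proof. by rewrite mulr_ge0 ?sqr_ge0// ltW. Qed.

Let u_le phi i : u phi i <= 2^-1 ^+ i.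
Proof.
rewrite /u /c mulrAC ler_pdivrMr ?ltr_pwDl ?sqr_ge0//.
rewrite ler_pM2l ?exprn_gt0//.
have h := re_state_bound (d i) phi.
rewrite -real_normK ?num_real// (@le_trans _ _ (M i ^+ 2)) ?lerDr//.
by rewrite ler_pXn2r// ?nnegrE// (le_trans _ h).
Qed.

Let partial n phi : R := \sum_(0 <= i < n) u phi i.

Let partialS n phi : partial n.+1 phi = partial n phi + u phi n.
Proof. by rewrite /partial big_nat_recr. Qed.

Let partial_tail n m phi : partial n phi <= partial (n + m)%N phi <= partial n phi + 2 * 2^-1 ^+ n.
Proof.
have h : partial n phi <= partial (n + m)%N phi <= partial n phi + 2 * 2^-1 ^+ n - 2 * 2^-1 ^+ (n + m).
  elim: m => [|m /andP[IH1 IH2]]; first by rewrite addn0 addrK lexx.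
  rewrite addnS partialS.
  have := u_ge0 phi (n + m)%N; have := u_le phi (n + m)%N.
  have -> : 2 * 2^-1 ^+ (n + m).+1 = 2^-1 ^+ (n + m) :> R by rewrite exprS mulrA divff// mul1r.
  by move=> v1 v2; apply/andP; split; lra.
have /andP[-> /le_trans ->//] := h.
by rewrite gerBl mulr_ge0// exprn_ge0.
Qed.

(* A weighted sum of squares of separating affine functions, hence strictly
   convex.  The sup of the partial sums is the sum of the series. *)
Let f phi : R := sup [set partial n phi | n in setT].

Let f_approx n phi : partial n phi <= f phi <= partial n phi + 2 * 2^-1 ^+ n.
Proof.
have ub : ubound [set partial k phi | k in setT] (partial n phi + 2 * 2^-1 ^+ n).
  move=> _ [k _ <-]; have /andP[_ h] := partial_tail n k phi.
  apply: le_trans h; rewrite addnC.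
  by have /andP[] := partial_tail k n phi.
apply/andP; split.
  by apply: ub_le_sup; [exists (partial n phi + 2 * 2^-1 ^+ n)|exists n].
by apply: ge_sup => //; exists (partial n phi), n.
Qed.

Let partial_continuous n : continuous (partial n).
Proof.
elim: n => [|n IH].
  rewrite (_ : partial 0 = fun=> 0); first exact: cst_continuous.
  by apply/funext => phi; rewrite /partial big_geq.
rewrite (_ : partial n.+1 = fun phi => partial n phi + u phi n); last first.
  by apply/funext => phi; rewrite partialS.
move=> phi; have FF : Filter (nbhs phi) := nbhs_filter phi.
apply: cvgD; first exact: IH.
apply: cvgMr; rewrite expr2; under eq_fun do rewrite expr2.
by apply: cvgM; exact: re_state_continuous.
Qed.

Let pow_half_lt (e : R) : 0 < e -> exists n, 2 * 2^-1 ^+ n < e.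
Proof.
move=> e0; have := @cvg_geometric R 2 2^-1.
rewrite ger0_norm ?(ltW half_gt0)// invf_lt1 ?ltr1n// => /(_ isT) /cvgrPdist_lt /(_ e e0) [n _ /(_ n)] /=.
rewrite leqnn sub0r normrN ger0_norm ?mulr_ge0 ?exprn_ge0// => /(_ isT) he.
by exists n.
Qed.

Let f_continuous : continuous f.
Proof.
move=> phi; have FF : Filter (nbhs phi) := nbhs_filter phi.
apply/cvgrPdist_lt => e e0.
have e3 : 0 < e / 3 by rewrite divr_gt0.
have [n hn] := pow_half_lt e3.
have /cvgrPdist_lt/(_ _ e3) := @partial_continuous n phi.
apply: filterS => psi; have /andP[] := f_approx n phi; have /andP[] := f_approx n psi.
move: hn; rewrite !ltr_norml => hn h1 h2 h3 h4 /andP[h5 h6].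
by apply/andP; split; lra.
Qed.

(** The parallelogram identity, applied to each square at the midpoint [omega]; of the resulting
    nonnegative excess only the [i]-th term is kept. *)
Let f_strict i psi1 psi2 omega :
  (forall b, 2 * re_state b omega = re_state b psi1 + re_state b psi2) ->
  2 * f omega + 2 * c i * (re_state (d i) psi1 - re_state (d i) omega) ^+ 2 <= f psi1 + f psi2.
Proof.
move=> h; apply/ler_addgt0Pr => e e0.
have e4 : 0 < e / 4 by rewrite divr_gt0.
have [n hn] := pow_half_lt e4.
have lem m : (i < m)%N -> 2 * partial m omega +
   2 * c i * (re_state (d i) psi1 - re_state (d i) omega) ^+ 2 <= partial m psi1 + partial m psi2.
  move=> im; have term k : 2 * u omega k +
      2 * c k * (re_state (d k) psi1 - re_state (d k) omega) ^+ 2 = u psi1 k + u psi2 k.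
    have mid : re_state (d k) omega = (re_state (d k) psi1 + re_state (d k) psi2) / 2.
      by rewrite -h mulrC mulKf.
    by rewrite /u mid; field.
  rewrite -big_split /= -(eq_bigr _ (fun k _ => term k)) big_split /= -big_distrr /=.
  rewrite lerD2l !big_mkord (bigD1 (Ordinal im))//= lerDl sumr_ge0// => k _.
  by rewrite mulr_ge0 ?sqr_ge0// mulr_ge0// ltW.
(* The cutoff exceeds [i], so the [i]-th term is present, and it is at least [n], so the tail is
   small. *)
have /andP[_ h1] := f_approx (n + i.+1) omega.
have /andP[h2 _] := f_approx (n + i.+1) psi1.
have /andP[h3 _] := f_approx (n + i.+1) psi2.
have h4 := lem (n + i.+1)%N (leq_addl _ _).
have h5 : 2 * 2^-1 ^+ (n + i.+1) < e / 4 :> R.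
  apply: le_lt_trans hn; rewrite ler_pM2l// exprD ler_piMr ?exprn_ge0//.
  by rewrite exprn_ile1// ?ltW// invf_lt1 ?ltr1n.
by lra.
Qed.

(* Choquet's theorem.  A measure that maximizes the integral of the strictly
   convex [f] among the measures with barycenter [phi] is concentrated on the
   pure states, since splitting points that are not pure would increase the
   integral. *)
Lemma exists_representing phi : exists mu, representing phi mu.
Proof.
have FF : Filter (nbhs phi) := nbhs_filter phi.
(* The points below the integrals of [f] over finitely supported measures, indexed by barycenter.
   The fibre [S] of the closure of [H] is used, because the approximations of a measure have
   barycenters that only tend to [phi]. *)
pose H := [set p : state B * R | exists D, [/\ prob_weights D,
  (forall b, re_state b p.1 = wsum D (re_state b)) & p.2 <= wsum D f]].
have [N fN] := state_fun_bounded f_continuous.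
have dirac_prob : prob_weights [:: (1 : R, phi)].
  by split => /=; rewrite ?ler01// /wsum big_seq1 mulr1.
pose S := [set s | closure H (phi, s)].
have S0 : S (f phi).
  apply: subset_closure; exists [:: (1, phi)]; split => // [b|].
    by rewrite /wsum big_seq1 mul1r.
  by rewrite /wsum big_seq1 mul1r.
have Sub : ubound S N.
  move=> s Ss.
  have cl : closed [set p : state B * R | p.2 <= N].
    by apply: (@closed_comp _ _ snd [set r : R | r <= N]) => [p _|]; [exact: cvg_snd|exact: closed_le].
  have : closure H `<=` [set p | p.2 <= N].
    rewrite ((closure_id _).1 cl); apply: closure_subset.
    move=> p [D [Dp _ /le_trans]]; apply; rewrite -(wsum_cst N Dp).
    apply: ler_wsum; first by have [] := Dp.
    by move=> q; have := fN q; rewrite ler_norml => /andP[].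
  by move=> /(_ _ Ss).
have Sc : closed S.
  apply: (@closed_comp _ _ (fun s : R => (phi, s)) (closure H)) => [s _|].
    move=> V [[V1 V2] [h1 h2] h]; apply: filterS h2 => r r2.
    by apply: h; split => //=; exact: nbhs_singleton h1.
  exact: closed_closure.
have Ssup : S (sup S).
  have := @closure_sup R S (ex_intro _ _ S0) (ex_intro _ _ Sub).
  by rewrite -((closure_id _).1 Sc).
have : closure H (phi, sup S) := Ssup.
rewrite closureEcvg => -[G GF [Gcvg GH]].
have [U [UU GU]] := ultraFilterLemma GF.
have UH : U H by apply: GU; apply: GH => p.
(* Outside [H] a Dirac measure is the default; [H] belongs to the ultrafilter, so the default does
   not affect limits. *)
have /choice[D hD] (p : state B * R) : exists D, prob_weights D /\
    (H p -> (forall b, re_state b p.1 = wsum D (re_state b)) /\ p.2 <= wsum D f).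
  have [[D [h1 h2 h3]]|nH] := pselect (H p); first by exists D.
  by exists [:: (1, phi)].
have ysep (p q : state B) : p <> q -> exists i, re_state (d i) p * re_state (d i) q < 0.
  by move=> /dsep[i /andP[h1 h2]]; exists i; rewrite nmulr_rlt0.
have [mu hmu] := @limit_measure R B d phi ysep _ U D UU (fun p => (hD p).1).
have Ucvg : U --> (phi, sup S) by move=> V /Gcvg/GU.
have rep b : \int[mu]_p re_state b p = re_state b phi.
  apply: (cvg_unique _ (hmu _ (@re_state_continuous _ _ b))); first exact: Rhausdorff.
  have h1 : (fun p : state B * R => re_state b p.1) @ U --> re_state b phi.
    have cont : (fun p : state B * R => re_state b p.1) @ (phi, sup S) --> re_state b phi.
      by apply: (cvg_comp _ _ cvg_fst); exact: re_state_continuous.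
    by move=> V Vn; apply: Ucvg; exact: cont.
  apply: cvg_trans h1; apply: near_eq_cvg.
  by apply: filterS UH => p Hp; have [_ /(_ Hp)[-> _]] := hD p.
have fS : sup S <= \int[mu]_p f p.
  have h1 : (fun p : state B * R => p.2) @ U --> sup S.
    have cont : (fun p : state B * R => p.2) @ (phi, sup S) --> sup S by exact: cvg_snd.
    by move=> V Vn; apply: Ucvg; exact: cont.
  apply: (ler_cvg_to h1 (hmu _ f_continuous)).
  by apply: filterS UH => p Hp; have [_ /(_ Hp)[_]] := hD p.
exists mu; split; last exact/representsP.
rewrite pureE; apply: (concentrated_maximal dsep); first exact: minorant_closed.
  by move=> psi; apply: minorant_refl; rewrite invf_le1 ?ler1n.
move=> i n; set e := n.+1%:R^-1; set K := gap _ _ _.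
have e0 : 0 < e by rewrite invr_gt0.
have mK : measurable (K : set (borel_state phi)).
  by apply: closed_borel; apply: closed_gap; exact: minorant_closed.
apply: contrapT => muK.
have t0 : 0 < fine (mu K) by exact: fine_probability_gt0.
have [E [Ep EK Ecvg]] := discretization dsep mu mK.
(* Each point is written as the midpoint of two states: in [K], a minorant of weight one half that
   is higher by [e] along [d i], with its complement; elsewhere, the point twice. *)
have /choice[sel hsel] (p : state B) : exists q : state B * state B,
    (forall b, 2 * re_state b p = re_state b q.1 + re_state b q.2) /\
    e * (p \in K)%:R <= re_state (d i) q.1 - re_state (d i) p.
  have [/set_mem[psi [h1 /= h2]]|pK] := boolP (p \in K); last first.
    by exists (p, p); split => [b|] /=; [rewrite mulr_natl|rewrite mulr0 subrr].
  have half1 : 2^-1 < 1 :> R by rewrite invf_lt1 ?ltr1n.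
  have [psi2 h3] := minorant_complement half1 h1.
  exists (psi, psi2); split => [b|] /=; last by rewrite mulr1 lerBrDl.
  by rewrite h3; lra.
have gain p : 2 * f p + 2 * c i * e ^+ 2 * (p \in K)%:R <= f (sel p).1 + f (sel p).2.
  have [h1 h2] := hsel p; apply: le_trans (f_strict i h1).
  rewrite lerD2l -mulrA ler_pM2l; last by rewrite mulr_gt0.
  move: h2; case: (p \in K) => /= [|_]; last by rewrite mulr0 sqr_ge0.
  by rewrite !mulr1 => h2; rewrite ler_pXn2r// nnegrE ltW// (lt_le_trans e0).
pose E' k := [seq (wp.1 / 2, (sel wp.2).1) | wp <- E k] ++ [seq (wp.1 / 2, (sel wp.2).2) | wp <- E k].
have E'E k g : wsum (E' k) g = 2^-1 * wsum (E k) (fun p => g (sel p).1 + g (sel p).2).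
  rewrite /wsum big_cat /= !big_map big_distrr -big_split /=.
  by apply: eq_bigr => wp _; field.
have E'p k : prob_weights (E' k).
  split.
    rewrite all_cat !all_map andbb; have [+ _] := Ep k; apply: sub_all => wp /= wp0.
    by rewrite divr_ge0.
  by rewrite E'E (wsum_cst _ (Ep k)) mulVf.
have /choice[v hv] k := barycenter (E'p k).
have vE k b : re_state b (v k) = wsum (E k) (re_state b).
  rewrite hv E'E -wsumZ; apply: eq_wsum => p.
  by rewrite -(hsel p).1 mulKf.
(* Splitting keeps the barycenters and raises the integral of [f] by at least [gn]. In the limit
   this puts a value above [sup S] into [S]. *)
set gn := c i * e ^+ 2 * fine (mu K).
have Hk k : H (v k, wsum (E k) f + gn).
  exists (E' k); split => //=.
  rewrite E'E /gn -(EK k) -wsumZ -wsumD -wsumZ; apply: ler_wsum; first by have [] := Ep k.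
  by move=> p; have := gain p; lra.
have : S (\int[mu]_p f p + gn).
  apply: (@closed_cvg _ _ \oo _ (fun k => (v k, wsum (E k) f + gn)) (closure H)) => //.
  - exact: closed_closure.
  - by exists 0%N => // k _; exact: subset_closure.
  - have c1 : v @ \oo --> phi.
      apply: state_cvgP => b; rewrite -rep; under eq_fun do rewrite vE.
      by apply: Ecvg; exact: re_state_continuous.
    have c2 : (fun k => wsum (E k) f + gn) @ \oo --> \int[mu]_p f p + gn.
      by apply: cvgD; [exact: Ecvg|exact: cvg_cst].
    move=> V [[V1 V2] [h1 h2] h].
    have n1 : \forall k \near \oo, V1 (v k) := c1 _ h1.
    have n2 : \forall k \near \oo, V2 (wsum (E k) f + gn) := c2 _ h2.
    by apply: filterS (filterI n1 n2) => k [k1 k2]; exact: h.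
move=> Sgn; have : \int[mu]_p f p + gn <= sup S by apply: ub_le_sup => //; exists N.
move=> /le_trans/(_ fS); rewrite gerDl leNgt => /negP; apply.
by apply: mulr_gt0 => //; apply: mulr_gt0 => //; exact: exprn_gt0.
Qed.

End Choquet.

(** * Dirac measures and the equivalence for boundaries *)

Lemma dirac_representing (R : realType) (B : unitalCStarAlgType R[i]) (phi : state B) (X : set (state B)) :
  pure B phi -> X phi -> Sigma_sub X phi.
Proof.
move=> pphi Xphi.
pose mu : probability (borel_state phi) R := @dirac _ (borel_state phi) phi R.
have m1 : measurable ([set phi] : set (borel_state phi)).
  apply: closed_borel; apply: accessible_closed_set1.
  exact: hausdorff_accessible (@state_hausdorff R B).
(* [A] need not be Borel; the measurable null set that covers its complement is the complement of
   the point [phi]. *)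
have conc (A : set (state B)) : A phi -> concentrated mu A.
  move=> Aphi; exists (~` [set phi]); split; first exact: measurableC.
    by rewrite /mu /= diracE memNset//; apply.
  by move=> psi nA /= e; apply: nA; rewrite e.
exists mu; last exact: conc.
split; first exact: conc.
apply/representsP => b.
have mb : measurable_fun setT (EFin \o (re_state b : borel_state phi -> R)).
  by apply/measurable_EFinP; apply: continuous_borel; exact: re_state_continuous.
by rewrite /Rintegral integral_dirac// diracT mul1e.
Qed.

Theorem corollary2p4 (R : realType) (B : unitalCStarAlgType R[i])
    (hB : separable B) (Delta : set (state B * state B))
    (hpre : preorder_set Delta) (hclosed : closed Delta)
    (hconv : convex_order Delta) :
  let Omega := pure_maximal Delta in
  ((exists X : set (state B),
      [/\ borel X, X `<=` pure B & maximal Delta = Sigma_sub X])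
     <-> boundary Delta Omega) /\
  (boundary Delta Omega <-> hyperrigid Delta).
Proof.
move=> Omega; have [d dsep] := separable_sign_separation hB.
have refl : forall phi, Delta (phi, phi) by have [] := hpre.
have max_sup : maximal Delta `<=` Sigma_sup Omega.
  move=> phi phimax mu [mup rep].
  have mumax := maximal_concentrated dsep hclosed hconv refl phimax rep.
  by rewrite /concentrated /Omega /pure_maximal setCI; exact: negligibleU.
(* The condition in [Sigma_sup] would be vacuous at a state without representing measures; Choquet's
   theorem excludes this. *)
have sup_sub (X : set (state B)) : Sigma_sup X `<=` Sigma_sub X.
  move=> phi h; have [mu rep] := exists_representing dsep phi.
  by exists mu => //; exact: h.
have Omega_borel : borel Omega.
  (* The Borel measurable space needs a state as base point. Without any state, all sets of states
     coincide. *)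
  have [phi0|noS] := pselect (exists phi : state B, True); last first.
    rewrite /borel (_ : Omega = setT); first exact: sub_sigma_algebra openT.
    by apply/seteqP; split=> // phi _; exfalso; apply: noS; exists phi.
  case: phi0 => phi0 _.
  have := measurableI (maximal Delta : set (borel_state phi0)) (pure B)
    (maximal_borel dsep hclosed refl) (pure_borel dsep (phi0 := phi0)).
  exact.
have rigid_boundary : hyperrigid Delta -> boundary Delta Omega.
  move=> rigid; split => //; first by move=> phi [].
    apply/seteqP; split=> // phi /sup_sub; exact: rigid.
  by apply/seteqP; split=> // phi /max_sup /sup_sub.
have boundary_rigid : boundary Delta Omega -> hyperrigid Delta.
  by move=> [_ _ _ e] phi; rewrite e.
split; last by split.
split=> [[X [_ Xpure XE]]|[h1 h2 _ h3]]; last by exists Omega.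
apply: rigid_boundary; rewrite /hyperrigid XE.
suff -> : pure_maximal Delta = X by [].
apply/seteqP; split=> phi.
  move=> [+ pphi]; rewrite XE => -[mu [_ rep] muX].
  apply: contrapT => Xphi.
  have h := pure_represents_set1 dsep pphi rep.
  (* For [phi] outside [X], the complements of [X] and of the point [phi] cover the state space, so
     a probability would vanish. *)
  have : mu.-negligible (setT : set (borel_state phi)).
    apply: negligibleS (negligibleU h muX) => psi _.
    by have [->|] := pselect (psi = phi); [right|left].
  move/negligibleP => /(_ measurableT) muT; have := probability_setT mu.
  by rewrite [X in X = _ -> _]muT => -[] /eqP; rewrite eq_sym oner_eq0.
move=> Xphi; split; last exact: Xpure.
by rewrite XE; apply: dirac_representing => //; exact: Xpure.
Qed.
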